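(* Let $\mathbb{F}$ be a field of characteristic $p>2$, let $\mathfrak{g}=\tilde{P}(2)$ over $\mathbb{F}$, let $a,b\in\mathbb{F}_p$, and let $K(\lambda)$ be the Kac module of $\mathfrak{g}$ with $\lambda=a\varepsilon_1+b\varepsilon_2$. Then $$\mathrm{H}^1(\mathfrak{g},K(\lambda))=\begin{cases}\mathbb{F}\varphi_1+\mathbb{F}\varphi_2, & a+b=-2 \text{ and } \Phi(b)=p-2,\\ \mathbb{F}\varphi_3, & a+b=-2 \text{ and } \Phi(b)=p-1,\\ \mathbb{F}\varphi_4, & a+b=-4 \text{ and } \Phi(b)=p-1,\\ 0, & \text{otherwise,}\end{cases}$$ where $\varphi_k$ stands for its class modulo $\mathrm{Ider}(\mathfrak{g},K(\lambda))$, equalities involving $a+b$ are in $\mathbb{F}_p$, and $\varphi_1,\dots,\varphi_4$ are the explicit linear maps $\mathfrak{g}\to K(\lambda)$ defined in the context.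
   Context: All vector spaces are finite-dimensional over a field $\mathbb{F}$ of characteristic $p>2$; $\mathbb{F}_p\subseteq\mathbb{F}$ is the prime field. For $c\in\mathbb{F}_p$, $\Phi(c)\in\{0,1,\dots,p-1\}\subseteq\mathbb{Z}$ is the integer with $\Phi(c)\equiv c \pmod p$. The Lie superalgebra. $\mathfrak{g}=\tilde{P}(2)$ is the subalgebra of $\mathfrak{gl}(2|2)$ (with supercommutator) of all $4\times4$ block matrices $\begin{pmatrix}A&B\\ C&-A^T\end{pmatrix}$ with $A,B,C$ of size $2\times 2$, $B=B^T$, $C=-C^T$; block diagonal matrices are even and block off-diagonal matrices are odd. With $e_{ij}$ the matrix units, put $\gamma=e_{41}-e_{32}$, $h_1=e_{33}-e_{11}$, $h_2=e_{44}-e_{22}$, $\alpha=e_{43}-e_{12}$, $\beta=e_{34}-e_{21}$. Then $\mathfrak{g}=\mathfrak{g}_{-1}\oplus\mathfrak{g}_0\oplus\mathfrak{g}_{+1}$ with bases: $\gamma$ of $\mathfrak{g}_{-1}$; $h_1,h_2,\alpha,\beta$ of $\mathfrak{g}_0$; $e_{13},e_{24},e_{14}+e_{23}$ of $\mathfrak{g}_{+1}$. These eight elements are the standard basis of $\mathfrak{g}$. Let $\mathfrak{h}=\langle h_1,h_2\rangle$ and let $\varepsilon_1,\varepsilon_2\in\mathfrak{h}^*$ satisfy $\varepsilon_i(h_j)=\delta_{ij}$. The Kac module. For $\lambda=a\varepsilon_1+b\varepsilon_2$ with $a,b\in\mathbb{F}_p$, $M(\lambda)$ is the simple $\mathfrak{g}_0$-module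 with basis $v_0,v_1,\dots,v_{\Phi(b-a)}$ and action $h_1v_k=(a+k)v_k$, $h_2v_k=(b-k)v_k$, $\alpha v_k=k(b-a-k+1)v_{k-1}$, $\beta v_k=v_{k+1}$ (with $v_{-1}=0$ and $v_{\Phi(b-a)+1}=0$). Let $\mathfrak{g}_{+1}$ act on $M(\lambda)$ by zero and set $K(\lambda)=U(\mathfrak{g})\otimes_{U(\mathfrak{g}_0\oplus\mathfrak{g}_{+1})}M(\lambda)$. It has basis $1\otimes v_k$ (even), $\gamma\otimes v_k$ (odd), $0\le k\le\Phi(b-a)$. Explicitly, with the same conventions on $v_{-1}$ and $v_{\Phi(b-a)+1}$: $h_1,h_2$ act on $1\otimes v_k$ by $a+k$, $b-k$ and on $\gamma\otimes v_k$ by $a+k+1$, $b-k+1$; $\alpha(u\otimes v_k)=k(b-a-k+1)\,u\otimes v_{k-1}$ and $\beta(u\otimes v_k)=u\otimes v_{k+1}$ for $u\in\{1,\gamma\}$; $\gamma(1\otimes v_k)=\gamma\otimes v_k$, $\gamma(\gamma\otimes v_k)=0$; $e_{13},e_{24},e_{14}+e_{23}$ kill $1\otimes v_k$; $e_{13}(\gamma\otimes v_k)=k(b-a-k+1)\,1\otimes v_{k-1}$, $(e_{14}+e_{23})(\gamma\otimes v_k)=(b-a-2k)\,1\otimes v_k$, $e_{24}(\gamma\otimes v_k)=-1\otimes v_{k+1}$. Cohomology. For a $\mathfrak{g}$-module $M$, a $\mathbb{Z}_2$-homogeneous linear map $\varphi:\mathfrak{g}\to M$ of parity $|\varphi|$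 is a derivation if $\varphi([x,y])=(-1)^{|\varphi||x|}x\varphi(y)-(-1)^{|y|(|\varphi|+|x|)}y\varphi(x)$ for all homogeneous $x,y\in\mathfrak{g}$. It is inner if there is a homogeneous $v\in M$ with $\varphi(x)=(-1)^{|x||v|}xv$ for all homogeneous $x\in\mathfrak{g}$. $\mathrm{Der}(\mathfrak{g},M)$ and $\mathrm{Ider}(\mathfrak{g},M)$ are the spans of all homogeneous derivations and of all inner derivations, and $\mathrm{H}^1(\mathfrak{g},M)=\mathrm{Der}(\mathfrak{g},M)/\mathrm{Ider}(\mathfrak{g},M)$. The maps $\varphi_k:\mathfrak{g}\to K(\lambda)$. These linear maps vanish on all standard basis elements not listed. If $a+b=-2$ and $\Phi(b)=p-2$: $\varphi_1:\ \alpha\mapsto\gamma\otimes v_{p-2},\ e_{13}\mapsto-1\otimes v_{p-2}$; and $\varphi_2:\ \beta\mapsto\gamma\otimes v_0,\ e_{24}\mapsto1\otimes v_0$. If $a+b=-2$ and $\Phi(b)=p-1$: $\varphi_3:\ h_1\mapsto\gamma\otimes v_0,\ h_2\mapsto\gamma\otimes v_0$. If $a+b=-4$ and $\Phi(b)=p-1$: $\varphi_4:\ e_{13}\mapsto2\gamma\otimes v_0,\ e_{24}\mapsto\gamma\otimes v_2,\ e_{14}+e_{23}\mapsto-2\gamma\otimes v_1$. *)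

(* Defs.v *)
From HB Require Import structures.
From mathcomp Require Import all_boot all_algebra.
From mathcomp Require Import ring classical_sets.

Set Implicit Arguments.
Unset Strict Implicit.
Unset Printing Implicit Defensive.
Import GRing.Theory.
Local Open Scope ring_scope.
Local Open Scope classical_set_scope.

Section Superalgebra.
Variable F : fieldType.
Implicit Types (X Y : 'M[F]_(2 + 2)) (i j : bool).

(* Parities are booleans: [false] is even, [true] is odd. *)
Definition gl_part (i : bool) X : 'M[F]_(2 + 2) :=
  if i then block_mx 0 (ursubmx X) (dlsubmx X) 0
  else block_mx (ulsubmx X) 0 0 (drsubmx X).

Definition scomm X Y : 'M[F]_(2 + 2) :=
  \sum_(i : bool) \sum_(j : bool)
    (gl_part i X *m gl_part j Y - (-1) ^+ (i && j) *: (gl_part j Y *m gl_part i X)).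

Definition pt2_defect X : 'M[F]_2 * 'M[F]_2 * 'M[F]_2 :=
  (drsubmx X + (ulsubmx X)^T, ursubmx X - (ursubmx X)^T, dlsubmx X + (dlsubmx X)^T).

Fact pt2_defect_linear : linear pt2_defect.
Proof.
move=> c X Y; congr (_, _, _); apply/matrixP=> k l; rewrite !mxE /=; ring.
Qed.

HB.instance Definition _ :=
  GRing.isLinear.Build F 'M[F]_(2 + 2) ('M[F]_2 * 'M[F]_2 * 'M[F]_2)%type *:%R
    pt2_defect pt2_defect_linear.

Definition pt2_space : {vspace 'M[F]_(2 + 2)} := lker (linfun pt2_defect).

Lemma mem_pt2 X :
  (X \in pt2_space) =
  [&& drsubmx X == - (ulsubmx X)^T, ursubmx X == (ursubmx X)^T
    & dlsubmx X == - (dlsubmx X)^T].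
Proof. by rewrite memv_ker lfunE !xpair_eqE subr_eq0 !addr_eq0 andbA. Qed.

Lemma mem_pt2_block (A B C : 'M[F]_2) :
  B = B^T -> C = - C^T -> block_mx A B C (- A^T) \in pt2_space.
Proof.
move=> hB hC; rewrite mem_pt2 block_mxKdr block_mxKul block_mxKur block_mxKdl.
by rewrite -hB -hC !eqxx.
Qed.

Lemma pt2_blockP X : X \in pt2_space ->
  exists A B C, [/\ B = B^T, C = - C^T & X = block_mx A B C (- A^T)].
Proof.
rewrite mem_pt2 => /and3P[/eqP hD /eqP hB /eqP hC].
exists (ulsubmx X), (ursubmx X), (dlsubmx X); split=> //.
by rewrite -hD submxK.
Qed.

Lemma scomm_block (A B C D A' B' C' D' : 'M[F]_2) :
  scomm (block_mx A B C D) (block_mx A' B' C' D') =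
  block_mx (A *m A' - A' *m A + (B *m C' + B' *m C))
           (A *m B' - B' *m D + (B *m D' - A' *m B))
           (C *m A' - D' *m C + (D *m C' - C' *m A))
           (D *m D' - D' *m D + (C *m B' + C' *m B)).
Proof.
rewrite /scomm !big_bool /= /gl_part.
rewrite !(block_mxKdr, block_mxKul, block_mxKur, block_mxKdl).
rewrite !mulmx_block !(mulmx0, mul0mx, addr0, add0r) expr0 expr1 !scale1r.
rewrite !scaleN1r !opprK.
rewrite !(add_block_mx, opp_block_mx) !(addr0, add0r, oppr0).
by congr block_mx; rewrite addrC.
Qed.

Lemma scomm_closed X Y :
  X \in pt2_space -> Y \in pt2_space -> scomm X Y \in pt2_space.
Proof.
move=> /pt2_blockP[A [B [C [hB hC ->]]]] /pt2_blockP[A' [B' [C' [hB' hC' ->]]]].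
rewrite scomm_block mem_pt2 block_mxKdr block_mxKul block_mxKur block_mxKdl.
have trD (P Q : 'M[F]_2) : (P + Q)^T = P^T + Q^T by exact: linearD.
have trN (P : 'M[F]_2) : (- P)^T = - P^T by exact: linearN.
rewrite !(trD, trN, trmx_mul, trmxK).
rewrite -hB -hB'.
have eC : C^T = - C by rewrite {2}hC opprK.
have eC' : C'^T = - C' by rewrite {2}hC' opprK.
rewrite eC eC' !(mulNmx, mulmxN, opprK, opprD).
apply/and3P; split; apply/eqP/matrixP=> k l; rewrite !mxE; ring.
Qed.

Local Notation pt2 := (subvs_of pt2_space).

Definition sbr (x y : pt2) : pt2 :=
  Subvs (scomm_closed (subvsP x) (subvsP y)).

Definition pt2_hom (i : bool) (x : pt2) : bool :=
  gl_part i (vsval x) == vsval x.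

(* Matrix units with indices counted from 1. *)
Definition mxunit (i j : nat) : 'M[F]_(2 + 2) :=
  \matrix_(k, l) ((k.+1 == i) && (l.+1 == j))%:R.
Local Notation E := mxunit.

(* h_1, h_2, alpha, beta, gamma, e_13, e_24, e_14 + e_23 *)
Definition std_mx : 8.-tuple 'M[F]_(2 + 2) :=
  [tuple E 3 3 - E 1 1; E 4 4 - E 2 2; E 4 3 - E 1 2; E 3 4 - E 2 1;
         E 4 1 - E 3 2; E 1 3; E 2 4; E 1 4 + E 2 3].

Definition std_basis : 8.-tuple pt2 := map_tuple (vsproj pt2_space) std_mx.

End Superalgebra.

Notation pt2 F := (subvs_of (pt2_space F)).

Section StandardBasis.
Variable F : fieldType.
Implicit Types (i : 'I_8).

Let ord2_0 (h : (0 < 2)%N) : Ordinal h = 0 :> 'I_2. Proof. exact: val_inj. Qed.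
Let ord2_1 (h : (1 < 2)%N) : Ordinal h = 1 :> 'I_2. Proof. exact: val_inj. Qed.

Lemma std_mx_in i : tnth (std_mx F) i \in pt2_space F.
Proof.
rewrite mem_pt2 (tnth_nth 0).
case: i; do 8?case=> //; move=> ? /=.
all: apply/and3P; split; apply/eqP/matrixP.
all: do 2![case; do 2?case=> //; move=> ?].
all: rewrite !mxE /= /addn /=; ring.
Qed.

Lemma std_basisE i : vsval (tnth (std_basis F) i) = tnth (std_mx F) i.
Proof. by rewrite tnth_map vsprojK // std_mx_in. Qed.

(* Coordinates in the standard basis, read off the blocks. *)
Definition std_entry (X : 'M[F]_(2 + 2)) : 8.-tuple F :=
  [tuple drsubmx X 0 0; drsubmx X 1 1; drsubmx X 1 0; drsubmx X 0 1;
         dlsubmx X 1 0; ursubmx X 0 0; ursubmx X 1 1; ursubmx X 0 1].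

Lemma std_decomp (X : 'M[F]_(2 + 2)) : (2%:R : F) != 0 -> X \in pt2_space F ->
  X = \sum_(i < 8) tnth (std_entry X) i *: tnth (std_mx F) i.
Proof.
move=> two_neq0 /pt2_blockP[A [B [C [hB hC ->]]]].
have diagC k : C k k = 0.
  apply/eqP; rewrite -(mulrI_eq0 _ (mulfI two_neq0)) mulr_natl mulr2n.
  by rewrite {1}hC !mxE addNr.
have symB : B 1 0 = B 0 1 by rewrite {1}hB mxE.
have skewC : C 0 1 = - C 1 0 by rewrite {1}hC !mxE.
rewrite !big_ord_recr big_ord0 /= add0r.
rewrite !(tnth_nth 0) /= block_mxKdr block_mxKur block_mxKdl.
rewrite -[RHS]submxK; congr block_mx.
all: apply/matrixP; do 2![case; do 2?case=> //; move=> ?].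
all: rewrite !mxE /= /addn /=.
all: rewrite ?ord2_0 ?ord2_1 ?diagC ?symB ?skewC; ring.
Qed.

Lemma std_entry_sum (k : 'I_8 -> F) j :
  tnth (std_entry (\sum_i k i *: tnth (std_mx F) i)) j = k j.
Proof.
rewrite !big_ord_recr big_ord0 /= add0r !(tnth_nth 0) /=.
case: j; do 8?case=> //; move=> h /=.
all: rewrite !mxE /= /addn /=.
all: rewrite ?(mulr0, mulr1, addr0, add0r, subr0, sub0r, mulrN).
all: rewrite ?oppr0 ?add0r ?addr0.
all: by congr (k _); apply: val_inj.
Qed.

Lemma std_basis_decomp x : (2%:R : F) != 0 ->
  x = \sum_(i < 8) tnth (std_entry (vsval x)) i *: tnth (std_basis F) i.
Proof.
move=> two_neq0; apply: val_inj; rewrite /= {1}(std_decomp two_neq0 (subvsP x)).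
by rewrite linear_sum; apply: eq_bigr=> i _; rewrite linearZ /= std_basisE.
Qed.

Lemma std_basis_free : free (std_basis F).
Proof.
apply/freeP=> k /(congr1 (@vsval _ _ _)); rewrite linear_sum linear0 => h i.
rewrite -(std_entry_sum k).
have -> : \sum_j k j *: tnth (std_mx F) j = 0.
  apply: etrans h; apply: eq_bigr=> j _.
  by rewrite linearZ -tnth_nth /= std_basisE.
by rewrite (tnth_nth 0); case: i; do 8?case=> //; move=> ? /=; rewrite !mxE.
Qed.

Lemma std_basisP : (2%:R : F) != 0 -> basis_of fullv (std_basis F).
Proof.
move=> two_neq0; rewrite /basis_of std_basis_free andbT eqEsubv subvf /=.
apply/subvP=> x _; rewrite (std_basis_decomp x two_neq0).
by apply: memv_suml=> i _; apply/memvZ/memv_span/mem_tnth.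
Qed.

Lemma coord_std i x : (2%:R : F) != 0 ->
  coord (std_basis F) i x = tnth (std_entry (vsval x)) i.
Proof.
move=> two_neq0; rewrite [in LHS](std_basis_decomp x two_neq0).
have -> : \sum_(i0 < 8) tnth (std_entry (vsval x)) i0 *: tnth (std_basis F) i0 =
  \sum_(i0 < 8) tnth (std_entry (vsval x)) i0 *: (std_basis F)`_i0.
  by apply: eq_bigr=> j _; rewrite -tnth_nth.
exact: coord_sum_free std_basis_free.
Qed.

(* The linear map with prescribed values on the standard basis, in its order. *)
Definition std_ext (V : vectType F) (w : 8.-tuple V) : 'Hom(pt2 F, V) :=
  linfun (fun x : pt2 F => \sum_(i < 8) coord (std_basis F) i x *: tnth w i).

Lemma std_extE (V : vectType F) (w : 8.-tuple V) x :
  std_ext w x = \sum_(i < 8) coord (std_basis F) i x *: tnth w i.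
Proof.
pose f (x : pt2 F) := \sum_(i < 8) coord (std_basis F) i x *: tnth w i.
have lin_f : linear f.
  move=> c y z; rewrite /f scaler_sumr -big_split; apply: eq_bigr=> i _ /=.
  by rewrite linearP scalerDl scalerA.
pose fl := GRing.isLinear.Build _ _ _ _ f lin_f.
pose ff : {linear pt2 F -> V} := HB.pack f fl.
exact: (lfunE ff x).
Qed.

Lemma std_ext_basis (V : vectType F) (w : 8.-tuple V) i :
  std_ext w (tnth (std_basis F) i) = tnth w i.
Proof.
rewrite std_extE (bigD1 i) //= big1 ?addr0 => [|j ji].
  by rewrite (tnth_nth 0 (std_basis F)) coord_free ?std_basis_free // eqxx scale1r.
rewrite (tnth_nth 0 (std_basis F)) coord_free ?std_basis_free //.
by rewrite eq_sym (negPf ji) scale0r.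
Qed.
End StandardBasis.

Section Cohomology.
Variable F : fieldType.

Record supermod := Supermod {
  smod_sort :> vectType F;
  smod_hom : bool -> {vspace smod_sort};
  smod_act : 'Hom(pt2 F, 'End(smod_sort));
  smod_hom_sum : (smod_hom false + smod_hom true)%VS = fullv;
  smod_hom_cap : (smod_hom false :&: smod_hom true)%VS = 0%VS;
  smod_act_hom : forall (i j : bool) (x : pt2 F) (v : smod_sort),
    pt2_hom i x -> v \in smod_hom j -> smod_act x v \in smod_hom (i (+) j);
  smod_act_sbr : forall (i j : bool) (x y : pt2 F) (v : smod_sort),
    pt2_hom i x -> pt2_hom j y ->
    smod_act (sbr x y) v =
      smod_act x (smod_act y v) - (-1) ^+ (i && j) *: smod_act y (smod_act x v)
}.

Variable M : supermod.
Local Notation act := (@smod_act M).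
Implicit Types (phi : 'Hom(pt2 F, M)) (i j k : bool).

Definition hom_parity k phi : Prop :=
  forall i x, pt2_hom i x -> phi x \in smod_hom M (k (+) i).

Definition derivation k phi : Prop :=
  hom_parity k phi /\
  forall i j (x y : pt2 F), pt2_hom i x -> pt2_hom j y ->
    phi (sbr x y) = (-1) ^+ (k && i) *: act x (phi y)
                    - (-1) ^+ (j && (k (+) i)) *: act y (phi x).

Definition homogeneous_derivation : set 'Hom(pt2 F, M) :=
  [set phi | exists k, derivation k phi].

Definition inner_derivation : set 'Hom(pt2 F, M) :=
  [set phi | homogeneous_derivation phi /\
    exists k (v : M), v \in smod_hom M k /\
      forall i x, pt2_hom i x -> phi x = (-1) ^+ (i && k) *: act x v].

Definition linspan (V : lmodType F) (S : set V) : set V :=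
  [set v | exists n (c : 'I_n -> F) (s : 'I_n -> V),
     (forall l, S (s l)) /\ v = \sum_l c l *: s l].

Definition Der : set 'Hom(pt2 F, M) := linspan homogeneous_derivation.
Definition Ider : set 'Hom(pt2 F, M) := linspan inner_derivation.

(* The class of phi modulo Ider, as a coset. *)
Definition Ider_class phi : set 'Hom(pt2 F, M) := [set psi | Ider (psi - phi)].

Definition H1 : set (set 'Hom(pt2 F, M)) := [set Ider_class phi | phi in Der].

End Cohomology.

Arguments Der [F] M _.
Arguments Ider [F] M _.
Arguments Ider_class [F] M phi _.
Arguments H1 [F] M _.

Section KacModule.
Variables (F : fieldType) (A B : F) (d : nat).

(* The first component is spanned by the 1 (x) v_k, the second by the
   gamma (x) v_k. *)
Definition kac_space : vectType F := ('rV[F]_d.+1 * 'rV[F]_d.+1)%type.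

(* Zero for k > d, as required by the convention on v_(d+1). *)
Definition kac_v (k : nat) : 'rV[F]_d.+1 := \row_j (j == k :> nat)%:R.
Definition kac_one (k : nat) : kac_space := (kac_v k, 0).
Definition kac_gam (k : nat) : kac_space := (0, kac_v k).

Definition kac_ext (w0 w1 : nat -> kac_space) : 'End(kac_space) :=
  linfun (fun u : kac_space =>
    \sum_(k < d.+1) (u.1 0 k *: w0 k + u.2 0 k *: w1 k)).

(* Actions of the standard basis elements, in the order of [std_mx], for the
   highest weight (A, B) and d = Phi (B - A).
   In alpha and e_13 the coefficient vanishes at k = 0, so v_(k.-1) is
   harmless. *)
Definition kac_ops : 8.-tuple 'End(kac_space) :=
  let c k : F := k%:R * (B - A - k%:R + 1) in
  [tuple
    kac_ext (fun k => (A + k%:R) *: kac_one k) (fun k => (A + k%:R + 1) *: kac_gam k);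
    kac_ext (fun k => (B - k%:R) *: kac_one k) (fun k => (B - k%:R + 1) *: kac_gam k);
    kac_ext (fun k => c k *: kac_one k.-1) (fun k => c k *: kac_gam k.-1);
    kac_ext (fun k => kac_one k.+1) (fun k => kac_gam k.+1);
    kac_ext (fun k => kac_gam k) (fun=> 0);
    kac_ext (fun=> 0) (fun k => c k *: kac_one k.-1);
    kac_ext (fun=> 0) (fun k => - kac_one k.+1);
    kac_ext (fun=> 0) (fun k => (B - A - 2%:R * k%:R) *: kac_one k)].

Definition kac_act : 'Hom(pt2 F, 'End(kac_space)) := std_ext kac_ops.

Definition kac_hom (i : bool) : {vspace kac_space} :=
  if i then lker (linfun (@fst 'rV[F]_d.+1 'rV[F]_d.+1))
  else lker (linfun (@snd 'rV[F]_d.+1 'rV[F]_d.+1)).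

Lemma mem_kac_hom i (u : kac_space) :
  (u \in kac_hom i) = if i then u.1 == 0 else u.2 == 0.
Proof. by case: i; rewrite memv_ker lfunE. Qed.

Fact kac_hom_sum : (kac_hom false + kac_hom true)%VS = fullv.
Proof.
apply/eqP; rewrite eqEsubv subvf; apply/subvP=> -[u0 u1] _.
apply/memv_addP; exists (u0, 0); first by rewrite mem_kac_hom.
exists (0, u1); first by rewrite mem_kac_hom.
by congr (_, _); rewrite /= ?addr0 ?add0r.
Qed.

Fact kac_hom_cap : (kac_hom false :&: kac_hom true)%VS = 0%VS.
Proof.
apply/eqP; rewrite -subv0; apply/subvP=> -[u0 u1].
rewrite memv_cap !mem_kac_hom /= memv0 => /andP[/eqP-> /eqP->].
exact: eqxx.
Qed.

Lemma kac_extE w0 w1 (u : kac_space) :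
  kac_ext w0 w1 u = \sum_(k < d.+1) (u.1 0 k *: w0 k + u.2 0 k *: w1 k).
Proof.
pose f (u : kac_space) : kac_space :=
  \sum_(k < d.+1) (u.1 0 k *: w0 k + u.2 0 k *: w1 k).
have lin_f : linear f.
  move=> c y z; rewrite /f scaler_sumr -big_split; apply: eq_bigr=> i _ /=.
  by rewrite !mxE !scalerDl scalerDr !scalerA addrACA.
pose fl := GRing.isLinear.Build _ _ _ _ f lin_f.
pose ff : {linear kac_space -> kac_space} := HB.pack f fl.
exact: (lfunE ff u).
Qed.

Lemma kac_v0 k : (d < k)%N -> kac_v k = 0.
Proof.
move=> dk; apply/rowP=> j; rewrite !mxE ltn_eqF // (leq_trans (ltn_ord j)) //.
Qed.

Lemma kac_one0 k : (d < k)%N -> kac_one k = 0.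
Proof. by move=> dk; rewrite /kac_one kac_v0. Qed.

Lemma kac_gam0 k : (d < k)%N -> kac_gam k = 0.
Proof. by move=> dk; rewrite /kac_gam kac_v0. Qed.

Lemma kac_ext_one w0 w1 k : ((d < k)%N -> w0 k = 0) ->
  kac_ext w0 w1 (kac_one k) = w0 k.
Proof.
move=> w0_gtd; rewrite kac_extE /=; case: (ltnP d k) => [dk|kd].
  rewrite w0_gtd //; apply: big1=> j _.
  by rewrite !mxE ltn_eqF ?scale0r ?addr0 // (leq_trans (ltn_ord j)).
rewrite (bigD1 (Ordinal (kd : (k < d.+1)%N))) //= big1 => [|j ji].
  by rewrite !mxE eqxx scale0r scale1r !addr0.
by rewrite !mxE -[_ == k](_ : (j == Ordinal (kd : (k < d.+1)%N)) = _) // (negPf ji) !scale0r addr0.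
Qed.

Lemma kac_ext_gam w0 w1 k : ((d < k)%N -> w1 k = 0) ->
  kac_ext w0 w1 (kac_gam k) = w1 k.
Proof.
move=> w1_gtd; rewrite kac_extE /=; case: (ltnP d k) => [dk|kd].
  rewrite w1_gtd //; apply: big1=> j _.
  by rewrite !mxE ltn_eqF ?scale0r ?addr0 // (leq_trans (ltn_ord j)).
rewrite (bigD1 (Ordinal (kd : (k < d.+1)%N))) //= big1 => [|j ji].
  by rewrite !mxE eqxx scale0r scale1r add0r addr0.
by rewrite !mxE -[_ == k](_ : (j == Ordinal (kd : (k < d.+1)%N)) = _) // (negPf ji) !scale0r addr0.
Qed.

Lemma kac_basis_decomp (u : kac_space) :
  u = \sum_(k < d.+1) (u.1 0 k *: kac_one k + u.2 0 k *: kac_gam k).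
Proof.
apply: injective_projections; rewrite /= (linear_sum fst, linear_sum snd) /=.
  apply/rowP=> j; rewrite summxE (bigD1 j) //= big1 => [|l lj].
    by rewrite !mxE eqxx mulr1 mulr0 !addr0.
  by rewrite !mxE eq_sym val_eqE (negPf lj) !mulr0 addr0.
apply/rowP=> j; rewrite summxE (bigD1 j) //= big1 => [|l lj].
  by rewrite !mxE eqxx mulr1 mulr0 add0r addr0.
by rewrite !mxE eq_sym val_eqE (negPf lj) !mulr0 addr0.
Qed.

Lemma kac_lfun_eq (V : vectType F) (f g : 'Hom(kac_space, V)) :
  (forall k, f (kac_one k) = g (kac_one k)) ->
  (forall k, f (kac_gam k) = g (kac_gam k)) -> f = g.
Proof.
move=> h0 h1; apply/lfunP=> u; rewrite (kac_basis_decomp u) !linear_sum.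
by apply: eq_bigr=> k _; rewrite !linearD !linearZ /= h0 h1.
Qed.

Hypothesis dE : d%:R = B - A :> F.
Hypothesis two_neq0 : (2%:R : F) != 0.

Definition kac_coef (k : nat) : F := k%:R * (B - A - k%:R + 1).

Let coef0 k (w : kac_space) : ((d < k)%N -> (d < k.-1)%N -> w = 0) ->
  (d < k)%N -> kac_coef k *: w = 0.
Proof.
move=> w0 dk; case: (ltngtP d.+1 k) => [dk1|dk1|<-].
- by rewrite w0 ?scaler0 //; case: k dk1 {w0 dk}.
- by move: dk1; rewrite ltnS leqNgt dk.
- by rewrite /kac_coef -natr1 dE [X in _ * X](_ : _ = 0) ?mulr0 ?scale0r //; ring.
Qed.

Section Act.
Variable x : pt2 F.
Let B' := ursubmx (vsval x).
Let C' := dlsubmx (vsval x).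
Let D' := drsubmx (vsval x).

Lemma kac_act_one k :
  kac_act x (kac_one k) =
    (D' 0 0 * (A + k%:R) + D' 1 1 * (B - k%:R)) *: kac_one k
    + (D' 1 0 * kac_coef k) *: kac_one k.-1 + D' 0 1 *: kac_one k.+1
    + C' 1 0 *: kac_gam k.
Proof.
rewrite /kac_act std_extE sum_lfunE !big_ord_recr big_ord0 /= add0r.
rewrite !scale_lfunE !(coord_std _ _ two_neq0) !(tnth_nth 0) /=.
rewrite !kac_ext_one ?scaler0 ?addr0 // => [|?|?|?|?|?].
- by rewrite !scalerA scalerDl.
- exact: kac_gam0.
- by apply: kac_one0; apply: leqW.
- by apply: coef0=> // *; apply: kac_one0.
- by rewrite kac_one0 ?scaler0.
- by rewrite kac_one0 ?scaler0.
Qed.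

Lemma kac_act_gam k :
  kac_act x (kac_gam k) =
    (D' 0 0 * (A + k%:R + 1) + D' 1 1 * (B - k%:R + 1)) *: kac_gam k
    + (D' 1 0 * kac_coef k) *: kac_gam k.-1 + D' 0 1 *: kac_gam k.+1
    + (B' 0 0 * kac_coef k) *: kac_one k.-1 - B' 1 1 *: kac_one k.+1
    + (B' 0 1 * (B - A - 2%:R * k%:R)) *: kac_one k.
Proof.
rewrite /kac_act std_extE sum_lfunE !big_ord_recr big_ord0 /= add0r.
rewrite !scale_lfunE !(coord_std _ _ two_neq0) !(tnth_nth 0) /=.
rewrite !kac_ext_gam ?scaler0 ?addr0 // => [|?|?|?|?|?|?|?].
- by rewrite !scalerA scalerDl scalerN.
- by rewrite kac_one0 ?scaler0.
- by rewrite kac_one0 ?oppr0 //; apply: leqW.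
- by apply: coef0=> // *; apply: kac_one0.
- by apply: kac_gam0; apply: leqW.
- by apply: coef0=> // *; apply: kac_gam0.
- by rewrite kac_gam0 ?scaler0.
- by rewrite kac_gam0 ?scaler0.
Qed.

End Act.

Lemma pt2_hom_blockP i (x : pt2 F) : pt2_hom i x -> exists P Q R : 'M[F]_2,
  [/\ vsval x = block_mx P Q R (- P^T), Q 1 0 = Q 0 1, R 0 1 = - R 1 0,
      forall l, R l l = 0 & if i then P = 0 else Q = 0 /\ R = 0].
Proof.
have [P [Q [R [hQ hR hx]]]] := pt2_blockP (subvsP x).
rewrite /pt2_hom hx => hi; exists P, Q, R; split=> //.
- by rewrite {1}hQ mxE.
- by rewrite {1}hR !mxE.
- move=> l; apply/eqP; rewrite -(mulrI_eq0 _ (mulfI two_neq0)) mulr_natl mulr2n.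
  by rewrite {1}hR !mxE addNr.
move: hi; rewrite /gl_part.
case: i; rewrite !(block_mxKdr, block_mxKul, block_mxKur, block_mxKdl).
all: by move=> /eqP/eq_block_mx[].
Qed.

End KacModule.

Section KacSupermodule.
Variables (F : fieldType) (A B : F) (d : nat).
Hypothesis dE : d%:R = B - A :> F.
Hypothesis two_neq0 : (2%:R : F) != 0.

Fact kac_act_sbr i j (x y : pt2 F) (v : kac_space F d) : pt2_hom i x -> pt2_hom j y ->
  kac_act A B d (sbr x y) v =
    kac_act A B d x (kac_act A B d y v) - (-1) ^+ (i && j) *: kac_act A B d y (kac_act A B d x v).
Proof.
move=> /(pt2_hom_blockP two_neq0)[P [Q [R [hx hQ hR hR0 hi]]]].
move=> /(pt2_hom_blockP two_neq0)[P' [Q' [R' [hy hQ' hR' hR0' hj]]]].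
have hxy : vsval (sbr x y) = scomm (vsval x) (vsval y) by [].
rewrite hx hy scomm_block in hxy.
have sum2 (f : 'I_2 -> F) : \sum_l f l = f 0 + f 1.
  by rewrite !big_ord_recr big_ord0 /= add0r; congr (f _ + f _); apply: val_inj.
have act1 := kac_act_one dE two_neq0; have actg := kac_act_gam dE two_neq0.
have actD z u w : kac_act A B d z (u + w) = kac_act A B d z u + kac_act A B d z w :> kac_space F d by rewrite linearD.
have actN z u : kac_act A B d z (- u) = - kac_act A B d z u :> kac_space F d by rewrite linearN.
have actZ z c u : kac_act A B d z (c *: u) = c *: kac_act A B d z u :> kac_space F d by rewrite linearZ.
suff : kac_act A B d (sbr x y) =
    (kac_act A B d x \o kac_act A B d y)%VF - (-1) ^+ (i && j) *: (kac_act A B d y \o kac_act A B d x)%VF :> 'End(kac_space F d).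
  by move->; rewrite !lfun_simp.
have eD k l : drsubmx (vsval (sbr x y)) k l =
    P 0 k * P' l 0 + P 1 k * P' l 1 - (P' 0 k * P l 0 + P' 1 k * P l 1)
    + (R k 0 * Q' 0 l + R k 1 * Q' 1 l + (R' k 0 * Q 0 l + R' k 1 * Q 1 l)).
  by rewrite hxy block_mxKdr !mxE !sum2 !mxE; ring.
have eB k l : ursubmx (vsval (sbr x y)) k l =
    P k 0 * Q' 0 l + P k 1 * Q' 1 l + (Q' k 0 * P l 0 + Q' k 1 * P l 1)
    - (Q k 0 * P' l 0 + Q k 1 * P' l 1) - (P' k 0 * Q 0 l + P' k 1 * Q 1 l).
  by rewrite hxy block_mxKur !mxE !sum2 !mxE; ring.
have eC k l : dlsubmx (vsval (sbr x y)) k l =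
    R k 0 * P' 0 l + R k 1 * P' 1 l + (P' 0 k * R 0 l + P' 1 k * R 1 l)
    - (P 0 k * R' 0 l + P 1 k * R' 1 l) - (R' k 0 * P 0 l + R' k 1 * P 1 l).
  by rewrite hxy block_mxKdl !mxE !sum2 !mxE; ring.
have xD k l : drsubmx (vsval x) k l = - P l k by rewrite hx block_mxKdr !mxE.
have yD k l : drsubmx (vsval y) k l = - P' l k by rewrite hy block_mxKdr !mxE.
have xB k l : ursubmx (vsval x) k l = Q k l by rewrite hx block_mxKur.
have yB k l : ursubmx (vsval y) k l = Q' k l by rewrite hy block_mxKur.
have xC k l : dlsubmx (vsval x) k l = R k l by rewrite hx block_mxKdl.
have yC k l : dlsubmx (vsval y) k l = R' k l by rewrite hy block_mxKdl.
have hi' : if i then forall k l, P k l = 0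
    else ((forall k l, Q k l = 0) * (forall k l, R k l = 0))%type.
  by case: i hi => [->|[-> ->]]; [|split]; move=> *; rewrite !mxE.
have hj' : if j then forall k l, P' k l = 0
    else ((forall k l, Q' k l = 0) * (forall k l, R' k l = 0))%type.
  by case: j hj => [->|[-> ->]]; [|split]; move=> *; rewrite !mxE.
have sep (u w : kac_space F d) :
    (forall f : kac_space F d -> F, (forall a b, f (a + b) = f a + f b) ->
       (forall a, f (- a) = - f a) -> (forall c a, f (c *: a) = c * f a) ->
       f u = f w) -> u = w.
  move=> h; apply: injective_projections; apply/rowP=> l.
    by apply: (h (fun a => a.1 0 l)) => *; rewrite /= !mxE.
  by apply: (h (fun a => a.2 0 l)) => *; rewrite /= !mxE.
have az1 := act1 (sbr x y); have azg := actg (sbr x y).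
have even1 z k (h : forall p q, dlsubmx (vsval z) p q = 0) :
    kac_act A B d z (kac_one F d k) =
      (drsubmx (vsval z) 0 0 * (A + k%:R) + drsubmx (vsval z) 1 1 * (B - k%:R))
        *: kac_one F d k
      + (drsubmx (vsval z) 1 0 * kac_coef A B k) *: kac_one F d k.-1
      + drsubmx (vsval z) 0 1 *: kac_one F d k.+1.
  by rewrite act1 h scale0r addr0.
have eveng z k (h : forall p q, ursubmx (vsval z) p q = 0) :
    kac_act A B d z (kac_gam F d k) =
      (drsubmx (vsval z) 0 0 * (A + k%:R + 1) +
       drsubmx (vsval z) 1 1 * (B - k%:R + 1)) *: kac_gam F d k
      + (drsubmx (vsval z) 1 0 * kac_coef A B k) *: kac_gam F d k.-1
      + drsubmx (vsval z) 0 1 *: kac_gam F d k.+1.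
  by rewrite actg !h !mul0r !scale0r subr0 !addr0.
have odd1 z k (h : forall p q, drsubmx (vsval z) p q = 0) :
    kac_act A B d z (kac_one F d k) = dlsubmx (vsval z) 1 0 *: kac_gam F d k.
  by rewrite act1 !h !mul0r !addr0 !scale0r !add0r.
have oddg z k (h : forall p q, drsubmx (vsval z) p q = 0) :
    kac_act A B d z (kac_gam F d k) =
      (ursubmx (vsval z) 0 0 * kac_coef A B k) *: kac_one F d k.-1
      - ursubmx (vsval z) 1 1 *: kac_one F d k.+1
      + (ursubmx (vsval z) 0 1 * (B - A - 2%:R * k%:R)) *: kac_one F d k.
  by rewrite actg !h !mul0r !addr0 !scale0r !add0r.
apply: kac_lfun_eq => k; rewrite !lfun_simp; apply: sep => f fD fN fZ.
all: case: i hi' {hi} => hi;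
  [have hx0 p q : drsubmx (vsval x) p q = 0 by rewrite xD hi oppr0
  |have hx0 p q : ursubmx (vsval x) p q = 0 by rewrite xB hi];
  [have x1 m := odd1 x m hx0; have xg m := oddg x m hx0
  |have x1 m := even1 x m (fun p q => etrans (xC p q) (hi.2 p q));
   have xg m := eveng x m hx0].
all: case: j hj' {hj} => hj;
  [have hy0 p q : drsubmx (vsval y) p q = 0 by rewrite yD hj oppr0
  |have hy0 p q : ursubmx (vsval y) p q = 0 by rewrite yB hj];
  [have y1 m := odd1 y m hy0; have yg m := oddg y m hy0
  |have y1 m := even1 y m (fun p q => etrans (yC p q) (hj.2 p q));
   have yg m := eveng y m hy0].
all: rewrite ?(az1, azg, x1, y1, xg, yg) !(actD, actN, actZ) ?(x1, y1, xg, yg).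
all: rewrite !(fD, fN, fZ) ?(eD, eB, eC, xD, yD, xB, yB, xC, yC).
all: rewrite ?hi ?hj ?(hQ, hQ', hR, hR', hR0, hR0') /kac_coef.
all: by case: k => [|k] /=; ring.
Qed.

Local Notation kac_space := (kac_space F d).
Local Notation kac_act := (kac_act A B d).
Local Notation kac_hom := (kac_hom F d).
Local Notation kac_v := (kac_v F d).
Local Notation kac_one := (kac_one F d).
Local Notation kac_gam := (kac_gam F d).
Local Notation kac_coef := (kac_coef A B).

Fact kac_act_hom i j (x : pt2 F) (v : kac_space) :
  pt2_hom i x -> v \in kac_hom j -> kac_act x v \in kac_hom (i (+) j).
Proof.
move=> /(pt2_hom_blockP two_neq0)[P [Q [R [hx _ _ _ hi]]]].
rewrite mem_kac_hom (kac_basis_decomp v) => hj.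
rewrite linear_sum; apply: memv_suml => k _; rewrite linearD !linearZ /=.
case: j hj => /eqP hj.
  rewrite -kac_basis_decomp in hj.
  rewrite hj [in X in X *: _]mxE scale0r add0r; apply: memvZ.
  rewrite kac_act_gam // hx block_mxKdr block_mxKur.
  case: i hi => [->|[-> _]]; rewrite mem_kac_hom /=.
    by rewrite !mxE !(oppr0, mul0r, scale0r, scaler0, addr0).
  by rewrite !mxE !(mul0r, oppr0, scale0r, scaler0, addr0).
rewrite -kac_basis_decomp in hj.
rewrite hj [in X in _ + X *: _]mxE scale0r addr0; apply: memvZ.
rewrite kac_act_one // hx block_mxKdr block_mxKdl.
case: i hi => [->|[_ ->]]; rewrite mem_kac_hom /=.
  by rewrite !mxE !(oppr0, mul0r, scale0r, scaler0, addr0).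
by rewrite !mxE !(mul0r, oppr0, scale0r, scaler0, addr0).
Qed.

Definition kac_gen : supermod F :=
  Supermod (@kac_hom_sum F d) (@kac_hom_cap F d) kac_act_hom kac_act_sbr.

Local Notation e i := (std_basis F)`_i.

Lemma std_hom (i : 'I_8) : pt2_hom (4 <= i)%N (tnth (std_basis F) i).
Proof.
rewrite /pt2_hom std_basisE (tnth_nth 0).
case: i; do 8?case=> //; move=> ? /=.
all: rewrite /gl_part -[eqbRHS]submxK; apply/eqP; congr block_mx.
all: apply/matrixP; do 2![case; do 2?case=> //; move=> ?].
all: by rewrite !mxE /= /addn /= ?(oppr0, addr0).
Qed.

Lemma vsval_gamma : vsval (e 4) = block_mx 0 0
  (\matrix_(k, l) ((k == 1 :> nat)%:R * (l == 0 :> nat)%:R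
                   - (k == 0 :> nat)%:R * (l == 1 :> nat)%:R)) 0.
Proof.
rewrite -(tnth_nth 0 (std_basis F) (Ordinal (isT : (4 < 8)%N))) std_basisE.
rewrite (tnth_nth 0) /= -[LHS]submxK; congr (block_mx _ _ _ _).
all: apply/matrixP; do 2![case; do 2?case=> //; move=> ?].
all: by rewrite !mxE /= /addn /=; ring.
Qed.

Lemma sbr_gamma (x : pt2 F) :
  sbr x (e 4) =
    - ursubmx (vsval x) 0 1 *: e 0 + ursubmx (vsval x) 0 1 *: e 1
    + ursubmx (vsval x) 0 0 *: e 2 + - ursubmx (vsval x) 1 1 *: e 3
    + (drsubmx (vsval x) 0 0 + drsubmx (vsval x) 1 1) *: e 4.
Proof.
have sum2 (f : 'I_2 -> F) : \sum_l f l = f 0 + f 1.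
  by rewrite !big_ord_recr big_ord0 /= add0r; congr (f _ + f _); apply: val_inj.
have [P [Q [R [hQ hR hx]]]] := pt2_blockP (subvsP x).
have symQ : Q 1 0 = Q 0 1 by rewrite {1}hQ mxE.
have hg := vsval_gamma.
have hxy : vsval (sbr x (e 4)) = scomm (vsval x) (vsval (e 4)) by [].
rewrite [LHS](std_basis_decomp _ two_neq0) !big_ord_recr big_ord0 /= add0r.
rewrite !(tnth_nth 0) /= hx hg scomm_block.
rewrite !(block_mxKdr, block_mxKul, block_mxKur, block_mxKdl).
rewrite !mxE !sum2 !mxE /= symQ.
rewrite !(mulr0, mulr1, mul0r, subr0, sub0r, addr0, add0r, mulrN, oppr0, opprK).
rewrite !scale0r !addr0 !mul1r !mulN1r.
by congr (_ + _ *: _); rewrite addrC.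
Qed.

(* The explicit module is induced from M(lambda), on which g_{+1} acts by zero:
   this is the universal property of U(g) (x)_{U(g_0 + g_{+1})} M(lambda). *)
Lemma kac_universal (W : supermod F) (f : 'Hom('rV[F]_d.+1, W)) :
  (forall k, (k <= d)%N ->
     [/\ smod_act W (e 0) (f (kac_v k)) = (A + k%:R) *: f (kac_v k),
         smod_act W (e 1) (f (kac_v k)) = (B - k%:R) *: f (kac_v k),
         smod_act W (e 2) (f (kac_v k)) =
           (k%:R * (B - A - k%:R + 1)) *: f (kac_v k.-1),
         smod_act W (e 3) (f (kac_v k)) = f (kac_v k.+1)
       & forall i, (5 <= i < 8)%N -> smod_act W (e i) (f (kac_v k)) = 0]) ->
  exists! psi : 'Hom(kac_space, W),
    (forall x u, psi (kac_act x u) = smod_act W x (psi u)) /\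
    (forall m, psi (m, 0) = f m).
Proof.
move=> hf.
pose g : W -> W := smod_act W (e 4).
pose p (u : kac_space) := f u.1 + g (f u.2).
have lin_p : linear p.
  move=> c y z; rewrite /p /g /= !linearP /=.
  by rewrite scalerDr addrACA.
pose pl := GRing.isLinear.Build _ _ _ _ p lin_p.
pose pp : {linear kac_space -> W} := HB.pack p pl.
have [psi psiE] : exists psi : 'Hom(kac_space, W), forall u, psi u = p u.
  by exists (linfun pp) => u; rewrite lfunE.
have f_gt k : (d < k)%N -> f (kac_v k) = 0 by move=> dk; rewrite kac_v0 ?linear0.
have {}hf k :
    [/\ smod_act W (e 0) (f (kac_v k)) = (A + k%:R) *: f (kac_v k),
        smod_act W (e 1) (f (kac_v k)) = (B - k%:R) *: f (kac_v k),
        smod_act W (e 2) (f (kac_v k)) = kac_coef k *: f (kac_v k.-1),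
        smod_act W (e 3) (f (kac_v k)) = f (kac_v k.+1)
      & forall i, (5 <= i < 8)%N -> smod_act W (e i) (f (kac_v k)) = 0].
  case: (leqP k d) => [/hf //|dk].
  have fk0 := f_gt k dk; have fk1 := f_gt k.+1 (leqW dk).
  split=> [||||i _]; rewrite ?fk1 ?fk0 ?linear0 ?scaler0 //.
  case: (ltngtP d.+1 k) => [dk1|dk1|<-].
  - by rewrite f_gt ?scaler0 //; case: k dk1 {dk fk0 fk1}.
  - by move: dk1; rewrite ltnS leqNgt dk.
  - by rewrite /kac_coef -natr1 dE (_ : (_ - (_ + 1) + 1) = 0) ?mulr0 ?scale0r //; ring.
have act_f x k : smod_act W x (f (kac_v k)) =
    (drsubmx (vsval x) 0 0 * (A + k%:R) + drsubmx (vsval x) 1 1 * (B - k%:R))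
      *: f (kac_v k)
    + (drsubmx (vsval x) 1 0 * kac_coef k) *: f (kac_v k.-1)
    + drsubmx (vsval x) 0 1 *: f (kac_v k.+1)
    + dlsubmx (vsval x) 1 0 *: g (f (kac_v k)).
  have [h0 h1 h2 h3 h5] := hf k.
  rewrite [in LHS](std_basis_decomp x two_neq0) linear_sum sum_lfunE.
  rewrite !big_ord_recr big_ord0 /= add0r !linearZ /= !scale_lfunE !(tnth_nth 0) /=.
  rewrite h0 h1 h2 h3 (h5 5%N isT) (h5 6%N isT) (h5 7%N isT) !scaler0 !addr0.
  by rewrite !scalerA scalerDl.
have hom4 : pt2_hom true (e 4).
  by have := std_hom (Ordinal (isT : (4 < 8)%N)); rewrite (tnth_nth 0).
have gg w : g (g w) = 0.
  have := smod_act_sbr w hom4 hom4.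
  rewrite sbr_gamma vsval_gamma block_mxKur block_mxKdr !mxE.
  rewrite !(oppr0, addr0, scale0r) linear0 zero_lfunE expr1 scaleN1r opprK.
  move=> /esym/eqP; rewrite -mulr2n -scaler_nat scaler_eq0 (negPf two_neq0) /=.
  by move/eqP.
have xg (i : 'I_8) (x := tnth (std_basis F) i) w : smod_act W x (g w) =
    smod_act W (sbr x (e 4)) w + (-1) ^+ (4 <= i)%N *: g (smod_act W x w).
  by rewrite (smod_act_sbr w (std_hom i) hom4) andbT subrK.
have act5 (c0 c1 c2 c3 c4 : F) w :
    smod_act W (c0 *: e 0 + c1 *: e 1 + c2 *: e 2 + c3 *: e 3 + c4 *: e 4) w =
    c0 *: smod_act W (e 0) w + c1 *: smod_act W (e 1) w
    + c2 *: smod_act W (e 2) w + c3 *: smod_act W (e 3) w + c4 *: g w.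
  by rewrite !linearD !linearZ !lfun_simp.
have sgnD (i : 'I_8) : (-1) ^+ (4 <= i)%N = 1 :> F \/
    forall r s, drsubmx (vsval (tnth (std_basis F) i)) r s = 0.
  have [P [Q [R [hx _ _ _]]]] := pt2_hom_blockP two_neq0 (std_hom i).
  rewrite hx block_mxKdr; case: (4 <= i)%N => [->|_]; [right=> r s|by left].
  by rewrite !mxE oppr0.
have sep (u w : W) : (forall h : W -> F, (forall a b, h (a + b) = h a + h b) ->
    (forall a, h (- a) = - h a) -> (forall c a, h (c *: a) = c * h a) ->
    h u = h w) -> u = w.
  move=> h; rewrite (coord_vbasis (memvf u)) (coord_vbasis (memvf w)).
  apply: eq_bigr => l _; congr (_ *: _); apply: h => *.
  - by rewrite linearD.
  - by rewrite linearN.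
  - by rewrite linearZ.
have psi_one k : psi (kac_one k) = f (kac_v k).
  by rewrite psiE /p /= linear0 /g linear0 addr0.
have psi_gam k : psi (kac_gam k) = g (f (kac_v k)).
  by rewrite psiE /p /= linear0 add0r.
have hom_std (i : 'I_8) : (psi \o kac_act (tnth (std_basis F) i))%VF
    = (smod_act W (tnth (std_basis F) i) \o psi)%VF.
  apply: kac_lfun_eq => k; rewrite !lfun_simp.
    by rewrite kac_act_one // !linearD !linearZ /= !psi_one psi_gam act_f.
  rewrite kac_act_gam // !linearD linearN !linearZ /= !psi_one !psi_gam.
  rewrite xg sbr_gamma.
  have [h0 h1 h2 h3 _] := hf k.
  rewrite act5 h0 h1 h2 h3 act_f.
  have gD u w : g (u + w) = g u + g w by rewrite /g linearD.
  have gZ c u : g (c *: u) = c *: g u by rewrite /g linearZ.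
  rewrite !(gD, gZ) gg scaler0 addr0.
  apply: sep => h hD hN hZ; rewrite !(hD, hN, hZ) /kac_coef.
  by case: (sgnD i) => [->|D0]; rewrite ?D0; ring.
have psi_hom x u : psi (kac_act x u) = smod_act W x (psi u).
  rewrite (std_basis_decomp x two_neq0) !linear_sum !sum_lfunE linear_sum.
  apply: eq_bigr => i _; rewrite !linearZ !scale_lfunE linearZ; congr (_ *: _).
  by move/lfunP/(_ u): (hom_std i); rewrite !lfun_simp.
exists psi; split=> [|psi' [hom' ext']].
  by split=> // m; rewrite psiE /p /= /g !linear0 addr0.
apply: kac_lfun_eq => k; first by rewrite psi_one ext'.
have -> : kac_gam k = kac_act (e 4) (kac_one k).
  rewrite kac_act_one // vsval_gamma block_mxKdr block_mxKdl !mxE /=.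
  by rewrite !(mul0r, mulr1, mulr0, subr0, addr0) !scale0r !add0r scale1r.
by rewrite hom' psi_hom psi_one ext'.
Qed.
End KacSupermodule.

Section PrimeField.
Variables (F : fieldType) (p : nat).

(* A residue in 'F_p is stored as its representative in {0, ..., p - 1}. *)
Definition Phi (c : 'F_p) : nat := c.

(* The embedding of the prime field in F. *)
Definition Fp_in (c : 'F_p) : F := (Phi c)%:R.

Lemma Fp_inB (charFp : p \in [pchar F]) (b a : 'F_p) :
  Fp_in (b - a) = Fp_in b - Fp_in a.
Proof.
have p_pr := pcharf_prime charFp.
have Fp_inD (x y : 'F_p) : Fp_in (x + y) = Fp_in x + Fp_in y.
  rewrite /Fp_in /Phi /= -natrD.
  by rewrite [X in (_ %% X)%N]Fp_cast // (GRing.natr_mod_pchar charFp).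
by apply/eqP; rewrite eq_sym subr_eq -Fp_inD subrK.
Qed.

Lemma two_neq0_pchar (charFp : p \in [pchar F]) (p_gt2 : (2 < p)%N) :
  (2%:R : F) != 0.
Proof. by rewrite -(dvdn_pcharf charFp) gtnNdvd. Qed.

Definition kac (charFp : p \in [pchar F]) (p_gt2 : (2 < p)%N) (a b : 'F_p) :
    supermod F :=
  kac_gen (Fp_inB charFp b a) (two_neq0_pchar charFp p_gt2).

Section Cocycles.
Variable d : nat.
Local Notation one := (kac_one F d).
Local Notation gam := (kac_gam F d).

(* Values on h_1, h_2, alpha, beta, gamma, e_13, e_24, e_14 + e_23. *)
Definition phi1 : 'Hom(pt2 F, kac_space F d) :=
  std_ext [tuple 0; 0; gam (p - 2)%N; 0; 0; - one (p - 2)%N; 0; 0].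

Definition phi2 : 'Hom(pt2 F, kac_space F d) :=
  std_ext [tuple 0; 0; 0; gam 0; 0; 0; one 0; 0].

Definition phi3 : 'Hom(pt2 F, kac_space F d) :=
  std_ext [tuple gam 0; gam 0; 0; 0; 0; 0; 0; 0].

Definition phi4 : 'Hom(pt2 F, kac_space F d) :=
  std_ext [tuple 0; 0; 0; 0; 0; 2%:R *: gam 0; gam 2; - (2%:R *: gam 1)].

End Cocycles.
End PrimeField.

(* Main.v *)
(* Write a cocycle in the coordinates 1 (x) v_k, gamma (x) v_k of the Kac module;
   a cocycle of parity k sends each basis element of g into one of the two
   copies of M(lambda).

   Even cocycles: bracketing with gamma, which is injective on 1 (x) M(lambda),
   shows that phi agrees on g_0 + g_{-1} with the inner derivation of the vector
   w with phi(gamma) = gamma w. What remains is a g_0-map from g_{+1} to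
   gamma (x) M(lambda), determined by the image of the highest weight vector
   e_13; that image is killed by alpha, hence a multiple of gamma (x) v_0, and its
   weight forces a = -3, b = -1.

   Odd cocycles: [gamma, gamma] = 0 gives phi(gamma) = 0, and bracketing g_{+1}
   with gamma shows that phi is determined by its restriction to g_0. As h_1 + h_2
   is central in g_0 and acts on gamma (x) M(lambda) by a + b + 2, this restriction
   is inner unless a + b = -2. If a + b = -2, then either d = Phi(b - a) is 0 and
   phi is a multiple of phi_3, or phi(h_1 + h_2) = 0 and phi is a cocycle of sl_2
   with values in the simple module of highest weight d. The latter is inner up to
   alpha |-> gamma (x) v_d and beta |-> gamma (x) v_0, which are cocycles only if
   d + 2 = 0 in F. *)
Require Import Defs.
From HB Require Import structures.
From mathcomp Require Import all_boot all_algebra.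
From mathcomp Require Import classical_sets.
From mathcomp Require Import ring.

Set Implicit Arguments.
Unset Strict Implicit.
Unset Printing Implicit Defensive.
Import GRing.Theory.
Local Open Scope ring_scope.
Local Open Scope classical_set_scope.

(** * Closure properties of linear spans *)

Section LinearSpan.
Variables (F : fieldType) (V : lmodType F) (S : set V).

Lemma linspan_gen v : S v -> linspan S v.
Proof.
by move=> Sv; exists 1%N, (fun=> 1), (fun=> v); split=> //; rewrite big_ord1 scale1r.
Qed.

Lemma linspan0 : linspan S 0.
Proof. by exists 0%N, (fun=> 0), (fun=> 0); split=> [[]|] //; rewrite big_ord0. Qed.

Lemma linspanP c v w : linspan S v -> linspan S w -> linspan S (c *: v + w).
Proof.
move=> [m [r [s [Ss ->]]]] [n [r' [s' [Ss' ->]]]].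
pose pick T (f : 'I_m -> T) (g : 'I_n -> T) (l : 'I_(m + n)) : T :=
  match split l with inl i => f i | inr j => g j end.
exists (m + n)%N, (pick _ (fun i => c * r i) r'), (pick _ s s'); split=> [l|].
  by rewrite /pick; case: (split l).
rewrite big_split_ord /= scaler_sumr; congr (_ + _).
  by apply: eq_bigr => i _; rewrite /pick (unsplitK (inl i)) scalerA.
by apply: eq_bigr => i _; rewrite /pick (unsplitK (inr i)).
Qed.

Lemma linspan_sub v w : linspan S v -> linspan S w -> linspan S (v - w).
Proof. by move=> Sv Sw; rewrite addrC -scaleN1r; apply: linspanP. Qed.

End LinearSpan.

(** * Derivations, classes modulo [Ider], and a criterion for computing [H1] *)

Section FirstCohomology.
Variables (F : fieldType) (M : supermod F).
Implicit Types (phi psi : 'Hom(pt2 F, M)).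

Lemma derivation_linear k c phi psi :
  derivation k phi -> derivation k psi -> derivation k (c *: phi + psi).
Proof.
move=> [hphi dphi] [hpsi dpsi]; split=> [i x hx|i j x y hx hy].
  by rewrite !lfun_simp rpredD ?rpredZ ?hphi ?hpsi.
rewrite !lfun_simp (dphi i j) // (dpsi i j) //.
by rewrite !linearP /= addrACA !scalerA [_ * c]mulrC.
Qed.

Lemma derivation0 k : derivation k (0 : 'Hom(pt2 F, M)).
Proof.
split=> [i x _|i j x y _ _]; first by rewrite lfun_simp mem0v.
by rewrite !lfun_simp !linear0 addr0.
Qed.

Lemma derivation_sub k phi psi :
  derivation k phi -> derivation k psi -> derivation k (phi - psi).
Proof.
by move=> dphi dpsi; rewrite addrC -scaleN1r; apply: derivation_linear.
Qed.

Lemma Ider_classP phi psi : Ider M (phi - psi) -> Ider_class M phi = Ider_class M psi.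
Proof.
move=> I; apply/seteqP; split=> th; rewrite /Ider_class /= => Ith.
  have -> : th - psi = 1 *: (th - phi) + (phi - psi) by rewrite scale1r addrA subrK.
  exact: linspanP.
have -> : th - phi = (th - psi) - (phi - psi) by rewrite opprB addrA subrK.
exact: linspan_sub.
Qed.

(** An element of [Der] mixes parities, so a family of representatives must absorb sums. Closure
    under linear combinations lets the representatives of the homogeneous summands be added, by
    induction on their number; each case of the theorem is thereby reduced to homogeneous
    derivations. *)
Lemma H1_image (T : Type) (D : set T) (f : T -> 'Hom(pt2 F, M)) :
    (exists2 t, D t & f t = 0) ->
    (forall c t u, D t -> D u -> exists2 w, D w & f w = c *: f t + f u) ->
    (forall t, D t -> Der M (f t)) ->
    (forall k phi, derivation k phi -> exists2 t, D t & Ider M (phi - f t)) ->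
  H1 M = [set Ider_class M (f t) | t in D].
Proof.
move=> f0 fP fDer Dinn; apply/seteqP; split=> C [].
  move=> _ [n [c [s [hs ->]]]] <-.
  suff [t Dt I] : exists2 t, D t & Ider M (\sum_l c l *: s l - f t).
    by exists t => //; apply/esym/Ider_classP.
  elim: n c s hs => [|n IHn] c s hs.
    have [t Dt ft] := f0; exists t => //.
    by rewrite big_ord0 ft subr0; apply: linspan0.
  have [t Dt I] := IHn (fun l => c (lift ord0 l)) _ (fun l => hs (lift ord0 l)).
  have [k hk] := hs ord0; have [u Du J] := Dinn _ _ hk.
  have [w Dw fw] := fP (c ord0) u t Du Dt; exists w => //.
  rewrite big_ord_recl fw opprD addrACA -scalerBr; exact: linspanP J I.
by move=> t Dt <-; exists (f t) => //; apply: fDer.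
Qed.

End FirstCohomology.

(** * The superbracket in coordinates of the standard basis *)

Section StandardCoordinates.
Variable F : fieldType.
Hypothesis two_neq0 : (2%:R : F) != 0.

Definition std_e (i : nat) : pt2 F := (std_basis F)`_i.
Local Notation e i := (std_e i).

(* Locked, because [/=] would turn a coordinate into a matrix entry. *)
Definition ent (x : pt2 F) : seq F := locked (val (std_entry (vsval x))).

Lemma ent_decomp x : x = \sum_(i < 8) (ent x)`_i *: e i.
Proof.
rewrite {1}(std_basis_decomp x two_neq0).
by apply: eq_bigr => i _; rewrite /ent -lock !(tnth_nth 0).
Qed.

Lemma ent_std i j : (i < 8)%N -> (j < 8)%N -> (ent (e i))`_j = (j == i)%:R.
Proof.
move=> hi hj.
have := std_entry_sum (fun k : 'I_8 => (k == Ordinal hi)%:R : F) (Ordinal hj).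
rewrite (bigD1 (Ordinal hi)) //= eqxx scale1r big1 => [|k /negPf->].
  by rewrite addr0 -std_basisE !(tnth_nth 0) /ent -lock => <-.
by rewrite scale0r.
Qed.

Lemma std_e_hom i : (i < 8)%N -> pt2_hom (4 <= i)%N (e i).
Proof. by move=> hi; have := std_hom F (Ordinal hi); rewrite (tnth_nth 0). Qed.

Lemma ent_hom k x i : pt2_hom k x -> (i < 8)%N -> (4 <= i)%N != k -> (ent x)`_i = 0.
Proof.
move=> /(pt2_hom_blockP two_neq0)[P [Q [R [hx _ _ _ hk]]]].
rewrite /ent -lock hx /std_entry.
case: k hk => [->|[-> ->]]; do 8?case: i => [|i] //; move=> _ _ /=.
all: by rewrite ?(block_mxKdr, block_mxKur, block_mxKdl) !mxE ?oppr0.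
Qed.

(** Structure constants of g, in the order of [std_mx]. The terms that pair coordinate 4 with 5, 6
    or 7 are symmetric in [x] and [y], since the bracket of two odd elements is an
    anticommutator. *)
Definition sbr_ent (x y : seq F) : seq F :=
  [:: x`_3 * y`_2 - y`_3 * x`_2 - x`_4 * y`_7 - y`_4 * x`_7;
      x`_2 * y`_3 - y`_2 * x`_3 + x`_4 * y`_7 + y`_4 * x`_7;
      x`_2 * y`_0 + x`_1 * y`_2 - y`_2 * x`_0 - y`_1 * x`_2 + x`_4 * y`_5 + y`_4 * x`_5;
      x`_0 * y`_3 + x`_3 * y`_1 - y`_0 * x`_3 - y`_3 * x`_1 - x`_4 * y`_6 - y`_4 * x`_6;
      (x`_0 + x`_1) * y`_4 - (y`_0 + y`_1) * x`_4;
      - x`_0 * y`_5 *+ 2 + y`_0 * x`_5 *+ 2 - x`_2 * y`_7 *+ 2 + y`_2 * x`_7 *+ 2;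
      - x`_1 * y`_6 *+ 2 + y`_1 * x`_6 *+ 2 - x`_3 * y`_7 *+ 2 + y`_3 * x`_7 *+ 2;
      - (x`_0 + x`_1) * y`_7 + (y`_0 + y`_1) * x`_7
        - x`_3 * y`_5 - x`_2 * y`_6 + y`_3 * x`_5 + y`_2 * x`_6].

Lemma ent_sbr x y i : (i < 8)%N -> (ent (sbr x y))`_i = (sbr_ent (ent x) (ent y))`_i.
Proof.
have sum2 (f : 'I_2 -> F) : \sum_l f l = f 0 + f 1.
  by rewrite !big_ord_recr big_ord0 /= add0r; congr (f _ + f _); apply: val_inj.
have skew (R : 'M[F]_2) : R = - R^T ->
    [/\ R 0 1 = - R 1 0, R 0 0 = 0 & R 1 1 = 0].
  have diag l : R = - R^T -> R l l = 0.
    move=> hR; apply/eqP; rewrite -(mulrI_eq0 _ (mulfI two_neq0)) mulr_natl mulr2n.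
    by rewrite {1}hR !mxE addNr.
  by move=> hR; split; [rewrite {1}hR !mxE | apply: diag | apply: diag].
have [P [Q [R [hQ /skew[R01 R00 R11] hx]]]] := pt2_blockP (subvsP x).
have [P' [Q' [R' [hQ' /skew[R01' R00' R11'] hy]]]] := pt2_blockP (subvsP y).
have Q10 : Q 1 0 = Q 0 1 by rewrite {1}hQ mxE.
have Q10' : Q' 1 0 = Q' 0 1 by rewrite {1}hQ' mxE.
have hxy : vsval (sbr x y) = scomm (vsval x) (vsval y) by [].
rewrite /ent -!lock hxy hx hy scomm_block /std_entry.
rewrite !(block_mxKdr, block_mxKur, block_mxKdl).
do 8?case: i => [|i] //; move=> _ /=.
all: rewrite !mxE !sum2 !mxE ?(R01, R00, R11, R01', R00', R11', Q10, Q10'); ring.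
Qed.

Lemma std_sbr i j : (i < 8)%N -> (j < 8)%N ->
  sbr (e i) (e j) =
  let delta m : seq F := mkseq (fun l => (l == m)%:R) 8 in
  \sum_(k < 8) (sbr_ent (delta i) (delta j))`_k *: e k.
Proof.
move=> hi hj /=; rewrite {1}(ent_decomp (sbr _ _)); apply: eq_bigr => k _.
by rewrite ent_sbr // /sbr_ent !ent_std // !nth_mkseq.
Qed.

End StandardCoordinates.

Arguments std_e : simpl never.

(** * Rows as elements of M(lambda), and the action on K(lambda) in these coordinates *)

Section WeightCoordinates.
Variables (F : fieldType) (A B : F) (d : nat).
Implicit Types (r s : 'rV[F]_d.+1) (k m : nat).
Local Notation coef := (kac_coef A B).

(** Total in [k], with value 0 above [d]: this is the convention v_(d+1) = 0, and it keeps index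
    shifts free of bound proofs. *)
Definition crd r k : F := if (k < d.+1)%N then r 0 (inord k) else 0.

Lemma crd_row (f : nat -> F) k : (k <= d)%N -> crd (\row_j f j) k = f k.
Proof. by move=> kd; rewrite /crd ltnS kd mxE inordK. Qed.

Lemma crd_out r k : (d < k)%N -> crd r k = 0.
Proof. by rewrite /crd ltnS ltnNge => /negPf->. Qed.

Lemma crdD r s k : crd (r + s) k = crd r k + crd s k.
Proof. by rewrite /crd; case: ifP; rewrite ?addr0 // mxE. Qed.

Lemma crdN r k : crd (- r) k = - crd r k.
Proof. by rewrite /crd; case: ifP; rewrite ?oppr0 // mxE. Qed.

Lemma crdZ c r k : crd (c *: r) k = c * crd r k.
Proof. by rewrite /crd; case: ifP; rewrite ?mulr0 // mxE. Qed.

Lemma crd0 k : crd 0 k = 0.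
Proof. by rewrite /crd; case: ifP; rewrite // mxE. Qed.

Lemma crd_v m k : (k <= d)%N -> crd (kac_v F d m) k = (k == m)%:R.
Proof. by move=> kd; rewrite (crd_row (fun j => (j == m)%:R)). Qed.

Lemma crd_eq r s : (forall k, (k <= d)%N -> crd r k = crd s k) -> r = s.
Proof.
move=> h; apply/rowP=> j; have := h j; rewrite /crd ltn_ord inord_val.
by apply; rewrite -ltnS ltn_ord.
Qed.

(* The actions of h_1, h_2, alpha and beta on M(lambda). *)
Definition opH1 r := \row_(j < d.+1) ((A + j%:R) * crd r j).
Definition opH2 r := \row_(j < d.+1) ((B - j%:R) * crd r j).
Definition opA r := \row_(j < d.+1) (coef j.+1 * crd r j.+1).
Definition opB r := \row_(j < d.+1) (if val j is k.+1 then crd r k else 0).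

Lemma crd_H1 r k : crd (opH1 r) k = (A + k%:R) * crd r k.
Proof.
case: (leqP k d) => kd; last by rewrite !crd_out ?mulr0.
by rewrite (crd_row (fun j => (A + j%:R) * crd r j)).
Qed.

Lemma crd_H2 r k : crd (opH2 r) k = (B - k%:R) * crd r k.
Proof.
case: (leqP k d) => kd; last by rewrite !crd_out ?mulr0.
by rewrite (crd_row (fun j => (B - j%:R) * crd r j)).
Qed.

Lemma crd_A r k : crd (opA r) k = coef k.+1 * crd r k.+1.
Proof.
case: (leqP k d) => kd; last by rewrite !crd_out ?mulr0 // leqW.
by rewrite (crd_row (fun j => coef j.+1 * crd r j.+1)).
Qed.

Lemma crd_B0 r : crd (opB r) 0 = 0.
Proof. by rewrite (crd_row (fun j => if j is k.+1 then crd r k else 0)). Qed.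

Lemma crd_BS r k : (k < d)%N -> crd (opB r) k.+1 = crd r k.
Proof. by move=> kd; rewrite (crd_row (fun j => if j is k.+1 then crd r k else 0)). Qed.

Definition crdE := (crdD, crdN, crdZ, crd0, crd_H1, crd_H2, crd_A).

Lemma opH1_linear c r s : opH1 (c *: r + s) = c *: opH1 r + opH1 s.
Proof. by apply: crd_eq => k _; rewrite !crdE; ring. Qed.

Lemma opH2_linear c r s : opH2 (c *: r + s) = c *: opH2 r + opH2 s.
Proof. by apply: crd_eq => k _; rewrite !crdE; ring. Qed.

Lemma opA_linear c r s : opA (c *: r + s) = c *: opA r + opA s.
Proof. by apply: crd_eq => k _; rewrite !crdE; ring. Qed.

Lemma opB_linear c r s : opB (c *: r + s) = c *: opB r + opB s.
Proof.
apply: crd_eq => -[|k] kd; first by rewrite !crdE !crd_B0 mulr0 addr0.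
by rewrite !crdE !crd_BS // !crdE.
Qed.

HB.instance Definition _ := GRing.isLinear.Build F _ _ *:%R opH1 opH1_linear.
HB.instance Definition _ := GRing.isLinear.Build F _ _ *:%R opH2 opH2_linear.
HB.instance Definition _ := GRing.isLinear.Build F _ _ *:%R opA opA_linear.
HB.instance Definition _ := GRing.isLinear.Build F _ _ *:%R opB opB_linear.

Lemma op_linear :
  ((opH1 0 = 0) * (opH2 0 = 0) * (opA 0 = 0) * (opB 0 = 0) *
   (forall r s, opH1 (r + s)%R = (opH1 r + opH1 s)%R) *
   (forall r s, opH2 (r + s)%R = (opH2 r + opH2 s)%R) *
   (forall r s, opA (r + s)%R = (opA r + opA s)%R) *
   (forall r s, opB (r + s)%R = (opB r + opB s)%R) *
   scalable opH1 * scalable opH2 * scalable opA * scalable opB)%type.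
Proof.
do 11?split; try exact: linear0; try exact: linearD; exact: linearZZ.
Qed.

Hypothesis dE : d%:R = B - A :> F.
Hypothesis two_neq0 : (2%:R : F) != 0.

(** The second factor vanishes because d = B - A in F; this makes alpha compatible with v_(d+1) =
    0. *)
Lemma coef_d1 : coef d.+1 = 0.
Proof. by rewrite /kac_coef -natr1 dE; ring. Qed.

Lemma opH1_v k : opH1 (kac_v F d k) = (A + k%:R) *: kac_v F d k.
Proof.
apply: crd_eq => m md; rewrite !crdE crd_v //.
by case: eqP => [->//|_]; rewrite !mulr0.
Qed.

Lemma opH2_v k : opH2 (kac_v F d k) = (B - k%:R) *: kac_v F d k.
Proof.
apply: crd_eq => m md; rewrite !crdE crd_v //.
by case: eqP => [->//|_]; rewrite !mulr0.
Qed.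

Lemma opA_v k : opA (kac_v F d k) = coef k *: kac_v F d k.-1.
Proof.
apply: crd_eq => m md; rewrite !crdE (crd_v _ md).
case: k => [|k]; rewrite /= ?eqSS.
  rewrite /kac_coef !mul0r; case: (leqP m.+1 d) => md'; last by rewrite crd_out ?mulr0.
  by rewrite crd_v // mulr0.
case: (leqP m.+1 d) => md'.
  by rewrite crd_v // eqSS; case: eqP => [->//|]; rewrite !mulr0.
rewrite crd_out // mulr0; case: eqP => [mk|]; last by rewrite mulr0.
by rewrite -mk (_ : m = d) ?coef_d1 ?mul0r //; apply/eqP; rewrite eqn_leq md -ltnS.
Qed.

Lemma opB_v k : opB (kac_v F d k) = kac_v F d k.+1.
Proof.
apply: crd_eq => -[|m] md; first by rewrite crd_B0 crd_v.
by rewrite crd_BS // !crd_v // ltnW.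
Qed.

Definition kac_opE := (opH1_v, opH2_v, opA_v, opB_v).

(** Both sides are linear in [u], so basis vectors suffice. On the odd copy e_13, e_24 and e_14 +
    e_23 act as alpha, - beta and h_2 - h_1, which are their brackets with gamma; the last one
    because B - A - 2k = (B - k) - (A + k). *)
Lemma kac_actE x (u : kac_space F d) (z := ent x) :
  kac_act A B d x u =
  (z`_0 *: opH1 u.1 + z`_1 *: opH2 u.1 + z`_2 *: opA u.1 + z`_3 *: opB u.1
     + z`_5 *: opA u.2 - z`_6 *: opB u.2 + z`_7 *: (opH2 u.2 - opH1 u.2),
   z`_0 *: (opH1 u.2 + u.2) + z`_1 *: (opH2 u.2 + u.2) + z`_2 *: opA u.2
     + z`_3 *: opB u.2 + z`_4 *: u.1).
Proof.
pose f (u : kac_space F d) : kac_space F d :=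
  (z`_0 *: opH1 u.1 + z`_1 *: opH2 u.1 + z`_2 *: opA u.1 + z`_3 *: opB u.1
     + z`_5 *: opA u.2 - z`_6 *: opB u.2 + z`_7 *: (opH2 u.2 - opH1 u.2),
   z`_0 *: (opH1 u.2 + u.2) + z`_1 *: (opH2 u.2 + u.2) + z`_2 *: opA u.2
     + z`_3 *: opB u.2 + z`_4 *: u.1).
have lin_f : linear f.
  move=> c v w; rewrite /f /= !linearP /=; congr (_, _).
    by apply: crd_eq => k _; rewrite !crdE; ring.
  by apply: crd_eq => k _; rewrite !crdE; ring.
pose fl := GRing.isLinear.Build _ _ _ _ f lin_f.
pose ff : {linear kac_space F d -> kac_space F d} := HB.pack f fl.
rewrite -[RHS](lfunE ff u); suff -> : kac_act A B d x = linfun ff by [].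
apply: kac_lfun_eq => k.
  rewrite lfunE kac_act_one // /= /f /= !kac_opE !linear0; congr (_, _).
    apply: crd_eq => m _; rewrite !crdE -/z /z /ent -lock /=; ring.
  apply: crd_eq => m _; rewrite !crdE -/z /z /ent -lock /=; ring.
rewrite lfunE kac_act_gam // /= /f /= !kac_opE !linear0; congr (_, _).
  apply: crd_eq => m _; rewrite !crdE -/z /z /ent -lock /=; ring.
apply: crd_eq => m _; rewrite !crdE -/z /z /ent -lock /=; ring.
Qed.

End WeightCoordinates.

(** Used as [apply: (eq_of_diff h)]: the goal is reduced to an identity that [ring] can close, with
    the equation [h] subtracted. *)
Lemma eq_of_diff (V : zmodType) (x y u v : V) : u = v -> x - y = u - v -> x = y.
Proof. by move=> -> /eqP; rewrite subrr subr_eq0 => /eqP. Qed.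

(** * Homogeneous derivations with values in the Kac module *)

Section KacDerivations.
Variables (F : fieldType) (A B : F) (d : nat).
Hypothesis dE : d%:R = B - A :> F.
Hypothesis two_neq0 : (2%:R : F) != 0.
Local Notation K := (kac_gen dE two_neq0).
Local Notation e i := (std_e F i).
Local Notation opH1 := (@opH1 F A d).
Local Notation opH2 := (@opH2 F B d).
Local Notation opA := (@opA F A B d).
Local Notation opB := (@opB F d).
Local Notation kv := (kac_v F d).
Implicit Types (r : 'rV[F]_d.+1) (u : kac_space F d).

(** These are the brackets on which the even and odd classifications evaluate the derivation
    identity. *)
Lemma std_sbr_table :
  ((sbr (e 0) (e 4) = 1 *: e 4) * (sbr (e 1) (e 4) = 1 *: e 4) *
   (sbr (e 2) (e 4) = 0) * (sbr (e 3) (e 4) = 0) *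
   (sbr (e 0) (e 5) = - 2%:R *: e 5) * (sbr (e 1) (e 5) = 0) *
   (sbr (e 2) (e 5) = 0) * (sbr (e 3) (e 5) = - 1 *: e 7) *
   (sbr (e 3) (e 7) = - 2%:R *: e 6) *
   (sbr (e 4) (e 4) = 0) * (sbr (e 5) (e 4) = 1 *: e 2) *
   (sbr (e 6) (e 4) = - 1 *: e 3) * (sbr (e 7) (e 4) = (- 1 *: e 0 + 1 *: e 1)%R) *
   (sbr (e 0) (e 1) = 0) * (sbr (e 0) (e 2) = - 1 *: e 2) *
   (sbr (e 1) (e 2) = 1 *: e 2) * (sbr (e 0) (e 3) = 1 *: e 3) *
   (sbr (e 1) (e 3) = - 1 *: e 3) * (sbr (e 2) (e 3) = (- 1 *: e 0 + 1 *: e 1)%R))%type.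
Proof.
do 18?split.
(* The basis is generalized so that simplification evaluates the structure constants only. *)
all: rewrite (std_sbr two_neq0) // /std_e !big_ord_recr big_ord0; move: (std_basis F) => v.
all: rewrite [sbr_ent _ _]/= /=.
all: rewrite ?mulr0 ?mul0r ?mulr1 ?mul1r ?mul0rn ?oppr0 ?subr0 ?addr0 ?sub0r ?add0r.
all: rewrite ?scale0r ?addr0 ?add0r.
all: by rewrite ?(subr0, addr0, add0r, oppr0, scale0r, mulNrn).
Qed.

Lemma kac_act_std u :
  ((kac_act A B d (e 0) u = (opH1 u.1, opH1 u.2 + u.2)%R) *
   (kac_act A B d (e 1) u = (opH2 u.1, opH2 u.2 + u.2)%R) *
   (kac_act A B d (e 2) u = (opA u.1, opA u.2)) *
   (kac_act A B d (e 3) u = (opB u.1, opB u.2)) *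
   (kac_act A B d (e 4) u = (0, u.1)) *
   (kac_act A B d (e 5) u = (opA u.2, 0)) *
   (kac_act A B d (e 6) u = (- opB u.2, 0)%R) *
   (kac_act A B d (e 7) u = (opH2 u.2 - opH1 u.2, 0)%R))%type.
Proof.
do 7?split.
all: rewrite (kac_actE dE two_neq0) !ent_std //=.
all: by rewrite !(scale0r, scale1r, subr0, sub0r, addr0, add0r, oppr0).
Qed.

Implicit Type phi : 'Hom(pt2 F, kac_space F d).

Lemma std_ext_e (w : 8.-tuple (kac_space F d)) i : (i < 8)%N -> std_ext w (e i) = w`_i.
Proof.
by move=> hi; have := std_ext_basis w (Ordinal hi); rewrite !(tnth_nth 0).
Qed.

Lemma derivation_e k phi : derivation (M := K) k phi -> forall i j,
  (i < 8)%N -> (j < 8)%N ->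
  phi (sbr (e i) (e j)) =
    (-1) ^+ (k && (4 <= i)%N) *: kac_act A B d (e i) (phi (e j))
    - (-1) ^+ ((4 <= j)%N && (k (+) (4 <= i)%N)) *: kac_act A B d (e j) (phi (e i)).
Proof. by case=> _ dphi i j hi hj; apply: (dphi _ _ _ _ (std_e_hom F hi) (std_e_hom F hj)). Qed.

Lemma derivation_row k phi i : derivation (M := K) k phi -> (i < 8)%N ->
  exists r, phi (e i) = if k (+) (4 <= i)%N then (0, r) else (r, 0).
Proof.
case=> hphi _ hi; have := hphi _ _ (std_e_hom F hi); rewrite mem_kac_hom.
case: (phi (e i)) => r s /=.
by case: ifP => _ /eqP->; [exists s | exists r].
Qed.

(** The sign in the inner formula depends on the parity of the argument, but a homogeneous element
    involves only basis elements of its own parity, so the sign factors out of its expansion. *)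
Lemma inner_derivation_e k phi (v : kac_space F d) : v \in kac_hom F d k ->
    derivation (M := K) k phi ->
    (forall i, (i < 8)%N ->
       phi (e i) = (-1) ^+ ((4 <= i)%N && k) *: kac_act A B d (e i) v) ->
  inner_derivation (M := K) phi.
Proof.
move=> hv dphi phiE; split; first by exists k.
exists k, v; split=> // i x hx.
rewrite (ent_decomp two_neq0 x) !linear_sum sum_lfunE scaler_sumr.
apply: eq_bigr => j _; rewrite !linearZ /= scale_lfunE.
case: (eqVneq (4 <= j)%N i) => [<-|ji].
  by rewrite phiE // scalerA mulrC -scalerA.
by rewrite (ent_hom two_neq0 hx) // !scale0r scaler0.
Qed.

(** * The maps [phi1] to [phi4] are derivations *)

Lemma ent_even (x : pt2 F) : pt2_hom false x ->
  (((ent x)`_4 = 0) * ((ent x)`_5 = 0) * ((ent x)`_6 = 0) * ((ent x)`_7 = 0))%type.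
Proof. by move=> hx; rewrite !(ent_hom two_neq0 hx). Qed.

Lemma ent_odd (x : pt2 F) : pt2_hom true x ->
  (((ent x)`_0 = 0) * ((ent x)`_1 = 0) * ((ent x)`_2 = 0) * ((ent x)`_3 = 0))%type.
Proof. by move=> hx; rewrite !(ent_hom two_neq0 hx). Qed.

Lemma std_ext_ent (w : 8.-tuple (kac_space F d)) x :
  std_ext w x = \sum_(i < 8) (ent x)`_i *: w`_i.
Proof.
rewrite std_extE; apply: eq_bigr => i _.
by rewrite coord_std // /ent -lock !(tnth_nth 0).
Qed.

(** Here [p - 2] is [d], and d = -2 in F, so gamma (x) v_d has weight (-1, 1), the weight of alpha.
    In coordinates the derivation identity becomes polynomial identities, one set for each pair of
    parities. *)
Lemma phi1_derivation p : A = 0 -> B = - 2%:R -> p = d.+2 ->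
  derivation (M := K) true (phi1 F p d).
Proof.
move=> A0 B2 ->.
have dd : d%:R = - 2%:R :> F by rewrite dE A0 B2 subr0.
have phiE x : phi1 F d.+2 d x = (- (ent x)`_5 *: kv d, (ent x)`_2 *: kv d).
  rewrite /phi1 subn2 /= std_ext_ent !big_ord_recr big_ord0 /=.
  apply: injective_projections;
    by rewrite /= !(oppr0, scaler0, addr0, add0r) ?scalerN ?scaleNr.
split=> [i x hx|i j x y hx hy].
  rewrite phiE mem_kac_hom; case: i hx => /= hx.
    by rewrite !(ent_odd hx) ?scale0r.
  by rewrite !(ent_even hx) oppr0 scale0r.
rewrite phiE !(ent_sbr two_neq0) // !phiE !(kac_actE dE two_neq0) /sbr_ent /=.
rewrite !(op_linear A B) !(kac_opE dE) (kac_v0 F (ltnSn d)).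
case: i hx => hx; [have X := ent_odd hx | have X := ent_even hx].
all: case: j hy => hy; [have Y := ent_odd hy | have Y := ent_even hy].
all: rewrite !(X, Y) /= ?expr0 ?expr1; apply: injective_projections => /=.
all: apply: crd_eq => k _; rewrite !crdE /kac_coef ?dd A0 B2; ring.
Qed.

(** Now gamma (x) v_0 has weight (1, -1), the weight of beta. *)
Lemma phi2_derivation : A = 0 -> B = - 2%:R -> derivation (M := K) true (phi2 F d).
Proof.
move=> A0 B2.
have phiE x : phi2 F d x = ((ent x)`_6 *: kv 0, (ent x)`_3 *: kv 0).
  rewrite std_ext_ent !big_ord_recr big_ord0 /=.
  by apply: injective_projections; rewrite /= !(scaler0, addr0, add0r).
split=> [i x hx|i j x y hx hy].
  rewrite phiE mem_kac_hom; case: i hx => /= hx.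
    by rewrite (ent_odd hx) scale0r.
  by rewrite (ent_even hx) scale0r.
rewrite phiE !(ent_sbr two_neq0) // !phiE !(kac_actE dE two_neq0) /sbr_ent /=.
rewrite !(op_linear A B) !(kac_opE dE).
case: i hx => hx; [have X := ent_odd hx | have X := ent_even hx].
all: case: j hy => hy; [have Y := ent_odd hy | have Y := ent_even hy].
all: rewrite !(X, Y) /= ?expr0 ?expr1; apply: injective_projections => /=.
all: apply: crd_eq => k _; rewrite !crdE /kac_coef A0 B2; ring.
Qed.

(** The vector gamma (x) v_0 is killed by all of g, and the sum of the h_1 and h_2 coordinates
    vanishes on every bracket. *)
Lemma phi3_derivation : A = - 1 -> B = - 1 -> d = 0%N ->
  derivation (M := K) true (phi3 F d).
Proof.
move=> A1 B1 d0.
have v1 : kv 1 = 0 by rewrite kac_v0 ?d0.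
have phiE x : phi3 F d x = (0, ((ent x)`_0 + (ent x)`_1) *: kv 0).
  rewrite std_ext_ent !big_ord_recr big_ord0 /=.
  apply: injective_projections;
    by rewrite /= !(oppr0, scaler0, addr0, add0r) ?scalerDl ?scaleNr.
split=> [i x hx|i j x y hx hy].
  rewrite phiE mem_kac_hom; case: i hx => /= hx.
    by rewrite !(ent_odd hx) addr0 scale0r.
  by rewrite eqxx.
rewrite phiE !(ent_sbr two_neq0) // !phiE !(kac_actE dE two_neq0) /sbr_ent /=.
rewrite !(op_linear A B) !(kac_opE dE) v1.
case: i hx => hx; [have X := ent_odd hx | have X := ent_even hx].
all: case: j hy => hy; [have Y := ent_odd hy | have Y := ent_even hy].
all: rewrite !(X, Y) /= ?expr0 ?expr1; apply: injective_projections => /=.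
all: apply: crd_eq => k _; rewrite !crdE /kac_coef A1 B1; ring.
Qed.

(** For this weight gamma (x) M(lambda) is isomorphic to g_{+1} over g_0, with gamma (x) v_0 of
    weight (-2, 0) like e_13; [phi4] is such an isomorphism extended by zero. *)
Lemma phi4_derivation : A = - 3%:R -> B = - 1 -> d = 2%N ->
  derivation (M := K) false (phi4 F d).
Proof.
move=> A1 B1 d0.
have v3 : kv 3 = 0 by rewrite kac_v0 ?d0.
have phiE x : phi4 F d x = (0, (ent x)`_5 *: (2%:R *: kv 0)
    + (ent x)`_6 *: kv 2 + (ent x)`_7 *: (- 2%:R *: kv 1)).
  rewrite std_ext_ent !big_ord_recr big_ord0 /=.
  apply: injective_projections;
    by rewrite /= !(oppr0, scaler0, addr0, add0r) ?scaleNr ?scalerN.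
split=> [i x hx|i j x y hx hy].
  rewrite phiE mem_kac_hom; case: i hx => /= hx.
    by rewrite eqxx.
  by rewrite !(ent_even hx) !scale0r !addr0.
rewrite phiE !(ent_sbr two_neq0) // !phiE !(kac_actE dE two_neq0) /sbr_ent /=.
rewrite !(op_linear A B) !(kac_opE dE) v3.
case: i hx => hx; [have X := ent_odd hx | have X := ent_even hx].
all: case: j hy => hy; [have Y := ent_odd hy | have Y := ent_even hy].
all: rewrite !(X, Y) /= ?expr0 ?expr1; apply: injective_projections => /=.
all: apply: crd_eq => k _; rewrite !crdE /kac_coef A1 B1; ring.
Qed.

(* The values on g_{+1} come from those on g_0, because
   phi([x, gamma]) = - gamma phi(x) for x in g_{+1}. *)
Lemma odd_derivation_rows phi : derivation (M := K) true phi ->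
  exists r0 r1 r2 r3,
    [/\ forall i, (i < 8)%N -> phi (e i) =
          [:: (0, r0); (0, r1); (0, r2); (0, r3); 0;
              (- r2, 0); (r3, 0); (r0 - r1, 0)]`_i,
        opH1 r1 + r1 = opH2 r0 + r0,
        - r2 = opH1 r2 + r2 - opA r0 /\ r2 = opH2 r2 + r2 - opA r1,
        r3 = opH1 r3 + r3 - opB r0 /\ - r3 = opH2 r3 + r3 - opB r1
      & r1 - r0 = opA r3 - opB r2].
Proof.
move=> dphi; have D := derivation_e dphi.
have [r0 f0] := derivation_row dphi (isT : (0 < 8)%N).
have [r1 f1] := derivation_row dphi (isT : (1 < 8)%N).
have [r2 f2] := derivation_row dphi (isT : (2 < 8)%N).
have [r3 f3] := derivation_row dphi (isT : (3 < 8)%N).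
have [r4 f4] := derivation_row dphi (isT : (4 < 8)%N).
have [r5 f5] := derivation_row dphi (isT : (5 < 8)%N).
have [r6 f6] := derivation_row dphi (isT : (6 < 8)%N).
have [r7 f7] := derivation_row dphi (isT : (7 < 8)%N).
rewrite /= in f0 f1 f2 f3 f4 f5 f6 f7.
pose fE := (f0, f1, f2, f3, f4, f5, f6, f7).
have phi0 : phi 0 = 0 by rewrite linear0.
have phiZ c x : phi (c *: x) = c *: phi x by rewrite linearZ.
have phiD x y : phi (x + y) = phi x + phi y by rewrite linearD.
have := D 4%N 4%N isT isT; have := D 5%N 4%N isT isT; have := D 6%N 4%N isT isT.
have := D 7%N 4%N isT isT; have := D 0%N 1%N isT isT; have := D 0%N 2%N isT isT.
have := D 1%N 2%N isT isT; have := D 0%N 3%N isT isT; have := D 1%N 3%N isT isT.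
have := D 2%N 3%N isT isT.
rewrite !std_sbr_table !(phi0, phiD, phiZ) !fE !kac_act_std /= !(op_linear A B) !scale1r.
move=> /(congr1 snd)/= E23 /(congr1 snd)/= E13 /(congr1 snd)/= E03.
move=> /(congr1 snd)/= E12 /(congr1 snd)/= E02 /(congr1 snd)/= E01.
move=> /(congr1 snd)/= E74 /(congr1 snd)/= E64 /(congr1 snd)/= E54 /(congr1 snd)/= E44.
rewrite ?(expr1, scaler0, scaleN1r, sub0r) in E23 E13 E02 E74 E64 E54 E44.
(* Since [gamma, gamma] = 0, the vector 2 gamma phi(gamma) vanishes, and gamma is injective on the
   even copy. *)
have r40 : r4 = 0.
  have : 2%:R *: r4 == 0 by rewrite scaler_nat mulr2n -oppr_eq0 opprD -E44.
  by rewrite scaler_eq0 (negPf two_neq0) => /eqP.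
exists r0, r1, r2, r3; split=> //.
- move=> i hi; do 8?case: i hi => [|i] hi //=; rewrite fE //.
  + by rewrite r40.
  + by rewrite E54 opprK.
  + by rewrite -[r6]opprK -E64 opprK.
  + by rewrite -[r7]opprK -E74 addrC opprB.
- by apply/eqP; rewrite -subr_eq0 -E01.
- by rewrite addrC.
Qed.

(** For [phi1], [phi2] and the inner derivation of (0, w), the values on g_{+1} come from those on
    g_0 by the same formula as for [phi], so a match on h_1, h_2, alpha and beta is enough. *)
Lemma odd_rows_inner p phi r0 r1 r2 r3 w c1 c2 :
    (forall i, (i < 8)%N -> phi (e i) =
          [:: (0, r0); (0, r1); (0, r2); (0, r3); 0;
              (- r2, 0); (r3, 0); (r0 - r1, 0)]`_i) ->
    r0 = opH1 w + w -> r1 = opH2 w + w ->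
    r2 = c1 *: kv (p - 2) + opA w -> r3 = c2 *: kv 0 + opB w ->
  forall i, (i < 8)%N -> phi (e i) =
    (c1 *: phi1 F p d + c2 *: phi2 F d) (e i)
    + (-1) ^+ (4 <= i)%N *: kac_act A B d (e i) (0, w).
Proof.
move=> phiE h0 h1 h2 h3 i hi.
have lin (f g : 'Hom(pt2 F, kac_space F d)) x :
    (c1 *: f + c2 *: g) x = c1 *: f x + c2 *: g x by rewrite !lfun_simp.
rewrite lin.
rewrite /phi1 /phi2 !(std_ext_e _ hi) (phiE _ hi).
do 8?case: i hi => [|i] hi //=; rewrite kac_act_std ?expr1 ?expr0 ?scaleN1r.
all: apply: injective_projections.
all: rewrite /= ?(linear0, scaler0, scale1r, oppr0, addr0, add0r, subr0) ?(h0, h1, h2, h3) //.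
- by rewrite opprD scalerN.
- by rewrite opprK.
- by rewrite opprB opprD addrACA subrr addr0.
Qed.

(** * Classification of derivations modulo inner ones in characteristic p, with d < p *)

Variable p : nat.
Hypothesis charFp : p \in [pchar F].
Hypothesis d_ltp : (d < p)%N.

Let dF k : (0 < k <= d)%N -> k%:R != 0 :> F.
Proof.
move=> /andP[k0 kd]; rewrite -(dvdn_pcharf charFp) gtnNdvd //.
exact: leq_ltn_trans d_ltp.
Qed.

(** The prime p divides d + 2, and a quotient of at least 2 would give 2p <= d + 2 <= p + 1, against
    p > 1. *)
Lemma p_eq_d2 : (2%:R + (B - A)) = 0 -> p = d.+2.
Proof.
rewrite -dE -natrD => /eqP; rewrite -(dvdn_pcharf charFp) add2n => /dvdnP[q dq].
have p1 := prime_gt1 (pcharf_prime charFp).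
case: q dq => [|[|q]] dq //; first by rewrite mul1n in dq.
have : (d.+2 < d.+3)%N by [].
rewrite {1}dq mulSn mulSn => h; have : (p + (p + q * p) < p.+2)%N.
  by apply: leq_trans h _; rewrite !ltnS.
by rewrite -addn2 ltn_add2l => /(leq_ltn_trans (leq_addr _ _)); rewrite ltnS leqNgt p1.
Qed.

(** In F the coefficient is k (d - k + 1), and both factors are integers between 1 and d, hence
    prime to p. *)
Lemma coef_neq0 k : (0 < k <= d)%N -> kac_coef A B k != 0.
Proof.
move=> /andP[k0 kd]; rewrite /kac_coef -dE mulf_neq0 ?dF ?k0 //.
by rewrite -natrB // natr1 dF //= ltn_subrL k0 (leq_trans k0 kd).
Qed.

(** Uniqueness of the highest weight vector of M(lambda): alpha sends v_k to a nonzero multiple of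
    v_(k-1) for 0 < k <= d. *)
Lemma opA_ker r : opA r = 0 -> r = crd r 0 *: kv 0.
Proof.
move=> Ar; apply: crd_eq => -[|k] kd; rewrite crdZ crd_v ?mulr1 // mulr0.
have /eqP := congr1 (fun s => crd s k) Ar.
by rewrite crd_A crd0 mulf_eq0 (negPf (coef_neq0 _)) //= => /eqP.
Qed.

Lemma even_derivation phi : derivation (M := K) false phi ->
  exists c w,
    (forall i, (i < 8)%N -> phi (e i) =
       c *: phi4 F d (e i) + kac_act A B d (e i) (w, 0)) /\
    (c != 0 -> A = - 3%:R /\ B = - 1).
Proof.
move=> dphi; have D := derivation_e dphi.
have [r0 f0] := derivation_row dphi (isT : (0 < 8)%N).
have [r1 f1] := derivation_row dphi (isT : (1 < 8)%N).
have [r2 f2] := derivation_row dphi (isT : (2 < 8)%N).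
have [r3 f3] := derivation_row dphi (isT : (3 < 8)%N).
have [r4 f4] := derivation_row dphi (isT : (4 < 8)%N).
have [r5 f5] := derivation_row dphi (isT : (5 < 8)%N).
have [r6 f6] := derivation_row dphi (isT : (6 < 8)%N).
have [r7 f7] := derivation_row dphi (isT : (7 < 8)%N).
rewrite /= in f0 f1 f2 f3 f4 f5 f6 f7.
pose fE := (f0, f1, f2, f3, f4, f5, f6, f7).
have phi0 : phi 0 = 0 by rewrite linear0.
have phiZ c x : phi (c *: x) = c *: phi x by rewrite linearZ.
have := D 0%N 4%N isT isT; have := D 1%N 4%N isT isT; have := D 2%N 4%N isT isT.
have := D 3%N 4%N isT isT; have := D 0%N 5%N isT isT; have := D 1%N 5%N isT isT.
have := D 2%N 5%N isT isT; have := D 3%N 5%N isT isT; have := D 3%N 7%N isT isT.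
rewrite !std_sbr_table !(phi0, phiZ) !fE !kac_act_std /= !(op_linear A B) !scale1r.
move=> /(congr1 snd)/= E6 /(congr1 snd)/= E7 /(congr1 snd)/= A5 /(congr1 snd)/= H25.
move=> /(congr1 snd)/= H15 /(congr1 snd)/= E3 /(congr1 snd)/= E2.
move=> /(congr1 snd)/= E1 /(congr1 snd)/= E0.
(* The shape of the relations that come from [h_i, gamma] = gamma. *)
have cancel3 x y z : x = y + x - z -> z = y :> 'rV[F]_d.+1.
  by move/eqP; rewrite eq_sym subr_eq addrC => /eqP/addrI.
have r5E : r5 = crd r5 0 *: kv 0 by apply: opA_ker; rewrite A5 subr0.
set c := crd r5 0 in r5E.
(* The element e_13 generates g_{+1} under beta: [beta, e_13] = -(e_14 + e_23) and
   [beta, e_14 + e_23] = -2 e_24, hence the halving below. *)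
have {}E7 : r7 = - c *: kv 1.
  by rewrite -[LHS]opprK -[X in - X]scaleN1r E7 subr0 r5E linearZ /= opB_v scaleNr.
have {}E6 : r6 = (c / 2%:R) *: kv 2.
  apply: (scalerI (_ : - 2%:R != 0)); first by rewrite oppr_eq0.
  rewrite E6 subr0 E7 linearZ /= opB_v scalerA; congr (_ *: _).
  by rewrite mulNr mulrCA divff ?mulr1.
(* The row [r4] is that of phi(gamma) = gamma w, and [phi4] sends e_13 to twice gamma (x) v_0. *)
exists (c / 2%:R), r4; split=> [i hi|c0].
  have c2 : c / 2%:R * 2%:R = c by rewrite divfK.
  rewrite /phi4 std_ext_e //.
  do 8?case: i hi => [|i] hi //=; rewrite !fE kac_act_std /= ?scaler0 ?add0r ?linear0 ?add0r.
  - by rewrite (cancel3 _ _ _ E0).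
  - by rewrite (cancel3 _ _ _ E1).
  - by move/eqP: E2; rewrite eq_sym subr_eq0 => /eqP->.
  - by move/eqP: E3; rewrite eq_sym subr_eq0 => /eqP->.
  - by [].
  - by apply: injective_projections; rewrite /= ?scaler0 addr0 // scalerA c2.
  - by apply: injective_projections; rewrite /= ?scaler0 addr0.
  - apply: injective_projections; rewrite /= ?(scaler0, oppr0) addr0 //.
    by rewrite scalerN scalerA c2 E7 scaleNr.
have {}c0 : c != 0 by apply: contraNneq c0 => ->; rewrite mul0r.
(* The brackets [h_1, e_13] = -2 e_13 and [h_2, e_13] = 0, read at v_0, give A + 1 = -2 and B + 1 =
   0. *)
have := congr1 (fun r => crd r 0) H15; rewrite /= !crdE -/c => /esym h1.
have := congr1 (fun r => crd r 0) H25; rewrite /= !crdE -/c => /esym h2.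
by split; apply: (mulIf c0); [apply: (eq_of_diff h1) | apply: (eq_of_diff h2)]; ring.
Qed.

Lemma odd_derivation phi : derivation (M := K) true phi ->
  (exists w c1 c2,
    (forall i, (i < 8)%N -> phi (e i) =
       (c1 *: phi1 F p d + c2 *: phi2 F d) (e i)
       + (-1) ^+ (4 <= i)%N *: kac_act A B d (e i) (0, w)) /\
    (c1 = 0 /\ c2 = 0 \/ [/\ A = 0, B = - 2%:R & p = d.+2]))
  \/ exists c, (forall i, (i < 8)%N -> phi (e i) = c *: phi3 F d (e i)) /\
      [/\ A = - 1, B = - 1 & d = 0%N].
Proof.
move=> /odd_derivation_rows[r0 [r1 [r2 [r3 [phiE E01 [E02 E12] [E03 E13] E23]]]]].
have crds r s : r = s -> forall k, crd r k = crd s k by move=> ->.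
(* [z] is the row of phi(h_1 + h_2), and [t] is the scalar by which h_1 + h_2 acts on the odd copy.
   Applying phi to [h_1 + h_2, x] = 0 gives x z = t phi(x) for x in g_0. *)
pose z := r0 + r1; pose t := A + B + 2%:R.
have z0 : opH1 z + z = t *: r0.
  apply: crd_eq => k _; have := crds _ _ E01 k; rewrite !crdE => h.
  by apply: (eq_of_diff h); rewrite /t; ring.
have z1 : opH2 z + z = t *: r1.
  apply: crd_eq => k _; have := crds _ _ (esym E01) k; rewrite !crdE => h.
  by apply: (eq_of_diff h); rewrite /t; ring.
have z2 : opA z = t *: r2.
  apply: crd_eq => k _; have := crds _ _ (congr2 +%R E02 E12) k; rewrite linearD !crdE => h.
  by apply: (eq_of_diff h); rewrite /t; ring.
have z3 : opB z = t *: r3.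
  apply: crd_eq => k _; have := crds _ _ (congr2 +%R E03 E13) k; rewrite linearD !crdE => h.
  by apply: (eq_of_diff h); rewrite /t; ring.
have [t0|t_neq0] := eqVneq t 0; last first.
  left; exists (t^-1 *: z), 0, 0; split; last by left.
  have unt r : r = t^-1 *: (t *: r) by rewrite scalerA mulVf ?scale1r.
  apply: (odd_rows_inner phiE); rewrite linearZ /= -?scalerDr ?(z0, z1, z2, z3) -?unt //.
    by rewrite scale0r add0r.
  by rewrite scale0r add0r.
rewrite t0 !scale0r in z0 z1 z2 z3.
(* For d = 0 the module M(lambda) is a line killed by alpha and beta, and t = 0 forces A = B = -1;
   only a common value on h_1 and h_2 survives. *)
have [d0|d_gt0] := posnP d.
  right; exists (crd r0 0).
  have BA : B = A by apply/eqP; rewrite -subr_eq0 -dE d0.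
  have A1 : A = - 1.
    apply: (mulfI two_neq0); apply: (eq_of_diff t0); rewrite /t BA; ring.
  have row0 (r s : 'rV[F]_d.+1) : crd r 0 = crd s 0 -> r = s.
    by move=> rs; apply: crd_eq => k kd; have -> : k = 0%N by apply/eqP; rewrite -leqn0 -d0.
  have A0 r : opA r = 0.
    by apply: row0; rewrite !crdE (@crd_out _ _ r 1) ?mulr0 // ltnS leqn0; apply/eqP.
  have B0 r : opB r = 0 by apply: row0; rewrite crd_B0 crd0.
  have H0 r : opH1 r + r = 0 by apply: row0; rewrite !crdE A1 addr0 mulN1r addNr.
  rewrite B0 A0 subr0 in E23.
  rewrite A0 H0 subr0 in E02; rewrite B0 H0 subr0 in E03.
  split; last by rewrite BA.
  have r2_0 : r2 = 0 by rewrite -[r2]opprK E02 oppr0.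
  have r1_0 : r1 = r0 by apply/eqP; rewrite -subr_eq0 E23.
  have r0E : r0 = crd r0 0 *: kv 0 by apply: row0; rewrite crdZ crd_v // mulr1.
  move=> i hi; rewrite phiE // /phi3 std_ext_e //.
  do 8?case: i hi => [|i] hi //=; rewrite ?r1_0 ?r2_0 ?E03 ?subrr ?oppr0 ?scaler0 //.
    by apply: injective_projections; rewrite /= ?scaler0.
  by apply: injective_projections; rewrite /= ?scaler0.
(* Being killed by alpha, [z] is a multiple of v_0; as d > 0, beta does not kill v_0. *)
have zE : z = 0.
  have zk := opA_ker z2.
  have := crds _ _ z3 1%N; rewrite crd_BS // crd0 => zc.
  by rewrite zk zc scale0r.
have r1E : r1 = - r0 by apply/eqP; rewrite -addr_eq0 addrC -/z zE.
(* [y] is the row of phi(h_2 - h_1), where h_2 - h_1 is the Cartan element of sl_2. *)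
pose y := r1 - r0.
have AB : A = - B - 2%:R by apply: (eq_of_diff t0); rewrite /t; ring.
(* [opB w] matches r3 above degree 0, and the last coefficient of [w] makes
   [opH2 w - opH1 w] equal to [y]. *)
pose wf k := if (k < d)%N then crd r3 k.+1 else - crd y d / d%:R.
pose w := \row_(j < d.+1) wf j.
have w_lt k : (k < d)%N -> crd w k = crd r3 k.+1.
  by move=> kd; rewrite (crd_row wf) 1?ltnW // /wf kd.
have dF0 : d%:R != 0 :> F by apply: dF; rewrite d_gt0 leqnn.
have w_d : d%:R * crd w d = - crd y d.
  by rewrite (crd_row wf) // /wf ltnn mulrC divfK.
have y0 k : crd y k = - (2%:R * crd r0 k) by rewrite /y r1E !crdE; ring.
(* At k = d the factor is -d, so this is the choice of the last coefficient of [w]; below d it is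
   the relation for [h_2 - h_1, beta] at degree k + 1. *)
have yE k : (k <= d)%N -> crd y k = (B - A - 2%:R * k%:R) * crd w k.
  rewrite leq_eqVlt => /predU1P[->|kd].
    by apply: (eq_of_diff w_d); rewrite -dE; ring.
  rewrite w_lt //; have := crds _ _ (congr2 (fun r s => s - r) E03 E13) k.+1.
  rewrite /y !crdE !crd_BS // -natr1 => h.
  by apply: (eq_of_diff h); ring.
left.
have r0E : r0 = opH1 w + w.
  apply: crd_eq => k kd; apply: (mulfI two_neq0).
  by apply: (eq_of_diff (etrans (esym (yE k kd)) (y0 k))); rewrite !crdE AB; ring.
have r1E' : r1 = opH2 w + w.
  rewrite r1E; apply: crd_eq => k kd; apply: (mulfI two_neq0).
  by apply: (eq_of_diff (esym (etrans (esym (yE k kd)) (y0 k)))); rewrite !crdE AB; ring.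
(* The image of beta misses degree 0 and that of alpha misses degree d; the two leftover
   coefficients are those of [phi2] and [phi1]. *)
have r3E : r3 = crd r3 0 *: kv 0 + opB w.
  apply: crd_eq => -[|k] kd; rewrite crdD crdZ crd_v //.
    by rewrite mulr1 crd_B0 addr0.
  by rewrite mulr0 add0r crd_BS // w_lt.
have r2E : r2 = crd r2 d *: kv d + opA w.
  apply: crd_eq => k kd; rewrite crdD crdZ crd_v // crd_A.
  move: kd; rewrite leq_eqVlt => /predU1P[->|kd].
    by rewrite eqxx mulr1 (coef_d1 dE) mul0r addr0.
  rewrite ltn_eqF // mulr0 add0r.
  (* At k + 1 = d the last coefficient of [w] need not agree with [r3], but the factor is then the
     vanishing coefficient at d + 1. *)
  have r3w : kac_coef A B k.+2 * crd r3 k.+2 = kac_coef A B k.+2 * crd w k.+1.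
    move: kd; rewrite leq_eqVlt => /predU1P[->|kd]; last by rewrite w_lt.
    by rewrite (coef_d1 dE) !mul0r.
  have := crds _ _ E23 k.+1; rewrite -/y yE // !crdE crd_BS // r3w => h.
  apply: (eq_of_diff h); rewrite /kac_coef -!natr1; ring.
(* Under h_2 - h_1, alpha has weight 2 and v_d has weight -d; likewise beta has weight -2 and v_0
   has weight d. Both leftovers are therefore killed by d + 2. *)
have c1_0 : (2%:R + (B - A)) * crd r2 d = 0.
  have := crds _ _ (congr2 (fun r s => s - r) E02 E12) d.
  rewrite !crdE (coef_d1 dE) !mul0r => h.
  by apply: (eq_of_diff h); rewrite dE; ring.
have c2_0 : (2%:R + (B - A)) * crd r3 0 = 0.
  have := crds _ _ (congr2 (fun r s => s - r) E03 E13) 0%N.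
  rewrite !crdE !crd_B0 => h.
  by apply: (eq_of_diff (esym h)); ring.
exists w, (crd r2 d), (crd r3 0); have [BA|BA] := eqVneq (2%:R + (B - A)) 0.
  have pE := p_eq_d2 BA; split.
    by apply: (odd_rows_inner phiE) => //; rewrite pE subn2.
  right; have B2 : B = - 2%:R.
    by apply: (mulfI two_neq0); apply: (eq_of_diff BA); rewrite AB; ring.
  by split=> //; rewrite AB B2; ring.
move/eqP: c1_0; rewrite mulf_eq0 (negPf BA) /= => /eqP c1_0.
move/eqP: c2_0; rewrite mulf_eq0 (negPf BA) /= => /eqP c2_0.
split; last by left.
apply: (odd_rows_inner phiE) => //.
(* The index [p - 2] need not be [d] here, but the coefficient is zero. *)
by rewrite c1_0 scale0r -(scale0r (kv d)) -{1}c1_0.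
Qed.

Lemma natr_inj_ltp m n : (m < p)%N -> (n < p)%N -> m%:R = n%:R :> F -> m = n.
Proof.
wlog mn : m n / (m <= n)%N => [wl mp np mnE|_ np /esym/eqP].
  by case: (leqP m n) => [mn|/ltnW nm]; [apply: wl | apply/esym/wl].
rewrite -subr_eq0 -natrB // -(dvdn_pcharf charFp) => pmn.
apply/eqP; rewrite eqn_leq mn leqNgt; apply/negP => mn'.
have : (n - m < p)%N by apply: leq_ltn_trans np; apply: leq_subr.
by rewrite ltnNge dvdn_leq // subn_gt0.
Qed.

(** In F, d = B - A = 2; this lifts to integers because d < p, and 2 < p because 2 is nonzero in
    F. *)
Lemma d_eq2 : A = - 3%:R -> B = - 1 -> d = 2%N.
Proof.
move=> A3 B1; apply: natr_inj_ltp; rewrite ?dE ?A3 ?B1 //; last by ring.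
rewrite ltn_neqAle prime_gt1 ?(pcharf_prime charFp) // andbT.
by apply: contraNneq two_neq0 => {1}->; rewrite pcharf0.
Qed.

Lemma d_eq0 : A = - 1 -> B = - 1 -> d = 0%N.
Proof.
move=> A1 B1; apply: natr_inj_ltp; rewrite ?dE ?A1 ?B1 ?subrr //.
exact: leq_ltn_trans d_ltp.
Qed.

Lemma even_Ider phi : derivation (M := K) false phi ->
  exists2 c, c = 0 \/ A = - 3%:R /\ B = - 1 & Ider K (phi - c *: phi4 F d).
Proof.
move=> dphi; have [c [w [phiE cP]]] := even_derivation dphi; exists c.
  by case: (eqVneq c 0) => [|/cP]; [left | right].
(* [inner_derivation] asks for a homogeneous derivation, so the multiple of [phi4] must be one:
   either it is zero or the weight is the exceptional one. *)
have dpsi : derivation (M := K) false (c *: phi4 F d).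
  have [->|/cP[A3 B1]] := eqVneq c 0; first by rewrite scale0r; apply: derivation0.
  rewrite -[_ *: _]addr0; apply: derivation_linear; last exact: derivation0.
  by apply: phi4_derivation => //; apply: d_eq2.
apply: linspan_gen; apply: (@inner_derivation_e false _ (w, 0)).
- by rewrite mem_kac_hom.
- exact: derivation_sub.
- by move=> i hi; rewrite !lfun_simp phiE // andbF expr0 scale1r addrC addrA addNr add0r.
Qed.

Lemma odd_Ider phi : derivation (M := K) true phi ->
  exists2 psi,
    [\/ psi = 0,
        [/\ A = 0, B = - 2%:R & exists c1 c2, psi = c1 *: phi1 F p d + c2 *: phi2 F d]
      | [/\ A = - 1, B = - 1 & exists c, psi = c *: phi3 F d]] & Ider K (phi - psi).
Proof.
have inn psi w : derivation (M := K) true phi -> derivation (M := K) true psi ->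
    (forall i, (i < 8)%N -> phi (e i) =
       psi (e i) + (-1) ^+ (4 <= i)%N *: kac_act A B d (e i) (0, w)) ->
    Ider K (phi - psi).
  move=> dphi dpsi phiE; apply: linspan_gen; apply: (@inner_derivation_e true _ (0, w)).
  - by rewrite mem_kac_hom.
  - exact: derivation_sub.
  - by move=> i hi; rewrite !lfun_simp phiE // andbT addrC addrA addNr add0r.
move=> dphi; have [] := odd_derivation dphi.
  move=> [w [c1 [c2 [phiE [[c1_0 c2_0]|[A0 B2 pE]]]]]].
    exists 0; first by constructor 1.
    by apply: (inn _ w) (derivation0 _ _) _ => // i /phiE; rewrite c1_0 c2_0 !scale0r add0r.
  exists (c1 *: phi1 F p d + c2 *: phi2 F d).
    by constructor 2; split=> //; exists c1, c2.
  apply: (inn _ w) phiE => //; apply: derivation_linear; first exact: phi1_derivation.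
  rewrite -[_ *: _]addr0; apply: derivation_linear; last exact: derivation0.
  exact: phi2_derivation.
move=> [c [phiE [A1 B1 d0]]]; exists (c *: phi3 F d).
  by constructor 3; split=> //; exists c.
apply: (inn _ 0) => // [|i hi]; last by rewrite phiE // linear0 scaler0 addr0 lfun_simp.
rewrite -[_ *: _]addr0; apply: derivation_linear; last exact: derivation0.
exact: phi3_derivation.
Qed.

Lemma Der_phi12 c1 c2 : A = 0 -> B = - 2%:R ->
  Der K (c1 *: phi1 F p d + c2 *: phi2 F d).
Proof.
move=> A0 B2; have pE : p = d.+2 by apply: p_eq_d2; rewrite A0 B2 subr0 addrN.
apply: linspanP; first by apply: linspan_gen; exists true; apply: phi1_derivation.
rewrite -[_ *: _]addr0; apply: linspanP; last exact: linspan0.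
by apply: linspan_gen; exists true; apply: phi2_derivation.
Qed.

Lemma Der_phi3 c : A = - 1 -> B = - 1 -> Der K (c *: phi3 F d).
Proof.
move=> A1 B1; rewrite -[_ *: _]addr0; apply: linspanP; last exact: linspan0.
by apply: linspan_gen; exists true; apply: phi3_derivation => //; apply: d_eq0.
Qed.

Lemma Der_phi4 c : A = - 3%:R -> B = - 1 -> Der K (c *: phi4 F d).
Proof.
move=> A3 B1; rewrite -[_ *: _]addr0; apply: linspanP; last exact: linspan0.
by apply: linspan_gen; exists false; apply: phi4_derivation => //; apply: d_eq2.
Qed.

End KacDerivations.

(** * Transfer of conditions from F_p to F *)

Section PrimeFieldEmbedding.
Variables (F : fieldType) (p : nat).
Hypothesis charFp : p \in [pchar F].
Implicit Types (x y : 'F_p).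

Lemma Phi_ltp x : (Phi x < p)%N.
Proof. by have := ltn_ord x; rewrite [X in (_ < X)%N]Fp_cast // (pcharf_prime charFp). Qed.

Lemma Fp_inN x : Fp_in F (- x) = - Fp_in F x.
Proof. by rewrite -[- x]add0r Fp_inB // /Fp_in /= sub0r. Qed.

Lemma Fp_inD x y : Fp_in F (x + y) = Fp_in F x + Fp_in F y.
Proof.
by rewrite -[y in LHS]opprK Fp_inB // Fp_inN opprK.
Qed.

Lemma Fp_in_natr n : Fp_in F (n%:R : 'F_p) = n%:R.
Proof.
by elim: n => [//|n IHn]; rewrite -!natr1 Fp_inD IHn; congr (_ + _).
Qed.

(** With [Phi_eq_subn], this turns the case conditions of the theorem into equations in F on the
    weight; it rests on the injectivity of residues below p. *)
Lemma Fp_in_eqN x n : (x == - n%:R) = (Fp_in F x == - n%:R).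
Proof.
apply/eqP/eqP => [->|h].
  by rewrite Fp_inN Fp_in_natr.
apply/eqP; rewrite -addr_eq0; apply/eqP/val_inj.
apply: (natr_inj_ltp charFp); [exact: (Phi_ltp (x + _)) | exact: (Phi_ltp 0) |].
have x0 : Fp_in F (x + n%:R) = 0 by rewrite Fp_inD Fp_in_natr h addNr.
exact: x0.
Qed.

Lemma Phi_eq_subn x n : (0 < n <= p)%N -> (Phi x == p - n)%N = (Fp_in F x == - n%:R).
Proof.
move=> /andP[n0 np]; have pF0 := pcharf0 charFp.
have -> : - n%:R = (p - n)%:R :> F by rewrite natrB // pF0 sub0r.
apply/eqP/eqP => [<-//|]; apply: (natr_inj_ltp charFp); first exact: Phi_ltp.
by rewrite ltn_subrL n0 prime_gt0 // (pcharf_prime charFp).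
Qed.

End PrimeFieldEmbedding.

Theorem proposition5p1 (F : fieldType) (p : nat) (charFp : p \in [pchar F])
    (p_gt2 : (2 < p)%N) (a b : 'F_p) :
  let K := kac charFp p_gt2 a b in
  let d := Phi (b - a) in
  H1 K =
    if (a + b == - 2%:R) && (Phi b == p - 2)%N then
      [set Ider_class K (c.1 *: phi1 F p d + c.2 *: phi2 F d) | c in [set: F * F]]
    else if (a + b == - 2%:R) && (Phi b == p - 1)%N then
      [set Ider_class K (c *: phi3 F d) | c in [set: F]]
    else if (a + b == - 4%:R) && (Phi b == p - 1)%N then
      [set Ider_class K (c *: phi4 F d) | c in [set: F]]
    else [set Ider_class K 0].
Proof.
move=> K d; set A := Fp_in F a; set B := Fp_in F b.
have dE : d%:R = B - A := Fp_inB charFp b a.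
have two_neq0 := two_neq0_pchar charFp p_gt2.
have d_ltp : (d < p)%N := Phi_ltp charFp (b - a).
have p1 : (0 < 1 <= p)%N by rewrite /= (ltnW (ltnW p_gt2)).
have p2 : (0 < 2 <= p)%N by rewrite /= (ltnW p_gt2).
rewrite !(Fp_in_eqN charFp) !(Phi_eq_subn charFp) // (Fp_inD charFp) -/A -/B.
have evenD (phi : 'Hom(pt2 F, K)) (dphi : derivation false phi) :=
  even_Ider charFp d_ltp dphi.
have oddD (phi : 'Hom(pt2 F, K)) (dphi : derivation true phi) :=
  odd_Ider charFp d_ltp dphi.
(* This and the next fact make the exceptional weights (0, -2), (-1, -1) and (-3, -1) mutually
   exclusive; the next one needs 2 to be nonzero. *)
have B12 : B = - 1 -> B = - 2%:R -> False.
  move=> -> h; have /eqP : 1 = 0 :> F by apply: (eq_of_diff h); ring.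
  by rewrite oner_eq0.
have A13 : A = - 1 -> A = - 3%:R -> False.
  move=> -> h; have /eqP : 2%:R = 0 :> F by apply: (eq_of_diff h); ring.
  by rewrite (negPf two_neq0).
have linZ (phi : 'Hom(pt2 F, K)) c (t u : F) :
    (c * t + u) *: phi = c *: (t *: phi) + u *: phi by rewrite scalerDl scalerA.
have linZ2 (phi psi : 'Hom(pt2 F, K)) c (t1 t2 u1 u2 : F) :
    (c * t1 + u1) *: phi + (c * t2 + u2) *: psi =
    c *: (t1 *: phi + t2 *: psi) + (u1 *: phi + u2 *: psi).
  by rewrite !linZ scalerDr addrACA.
have A_of n m : A + B = - n%:R -> B = - m%:R -> A = m%:R - n%:R.
  by move=> AB Bm; rewrite -(addrK B A) AB Bm opprK addrC.
case: ifP => [/andP[/eqP AB2 /eqP B2]|no12].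
  have A0 : A = 0 by rewrite (A_of _ _ AB2 B2) subrr.
  apply: (H1_image (M := K)).
  - by exists (0, 0); rewrite //= !scale0r addr0.
  - by move=> c t u _ _; exists (c * t.1 + u.1, c * t.2 + u.2); rewrite //= linZ2.
  - by move=> t _; apply: Der_phi12.
  move=> [] phi dphi.
    have [psi [->|[_ _ [c1 [c2 ->]]]|[_ B1]] I] := oddD _ dphi.
    + by exists (0, 0); rewrite //= !scale0r addr0.
    + by exists (c1, c2).
    + by case: (B12 B1 B2).
  have [c [->|[_ B1]] I] := evenD _ dphi; last by case: (B12 B1 B2).
  by exists (0, 0) => //; rewrite /= !scale0r addr0; rewrite scale0r in I.
case: ifP => [/andP[/eqP AB2 /eqP B1]|no3].
  have A1 : A = - 1 by rewrite (A_of _ _ AB2 B1); ring.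
  apply: (H1_image (M := K)).
  - by exists 0; rewrite //= scale0r.
  - by move=> c t u _ _; exists (c * t + u); rewrite //= linZ.
  - by move=> t _; apply: (Der_phi3 _ _ charFp d_ltp).
  move=> [] phi dphi.
    have [psi [->|[_ B2 _]|[_ _ [c ->]]] I] := oddD _ dphi.
    + by exists 0; rewrite //= scale0r.
    + by case: (B12 B1 B2).
    + by exists c.
  have [c [->|[A3 _]] I] := evenD _ dphi; last by case: (A13 A1 A3).
  by rewrite scale0r in I; exists 0; rewrite ?scale0r.
case: ifP => [/andP[/eqP AB4 /eqP B1]|no4].
  have A3 : A = - 3%:R by rewrite (A_of _ _ AB4 B1); ring.
  apply: (H1_image (M := K)).
  - by exists 0; rewrite //= scale0r.
  - by move=> c t u _ _; exists (c * t + u); rewrite //= linZ.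
  - by move=> t _; apply: (Der_phi4 _ _ charFp d_ltp).
  move=> [] phi dphi.
    have [psi [->|[_ B2 _]|[A1 _ _]] I] := oddD _ dphi.
    + by exists 0; rewrite //= scale0r.
    + by case: (B12 B1 B2).
    + by case: (A13 A1 A3).
  by have [c _ I] := evenD _ dphi; exists c.
(* The vanishing case is the family whose only member is the zero map; any other representative
   would put the weight into a case already excluded. *)
rewrite -(image_set1 (Ider_class K)); apply: (H1_image (M := K) (f := id)).
- by exists 0.
- by move=> c t u -> ->; exists 0; rewrite //= scaler0 addr0.
- by move=> t ->; apply: linspan0.
move=> [] phi dphi.
  have [psi [->|[A0 B2 _]|[A1 B1 _]] I] := oddD _ dphi; first by exists 0.
  - by move: no12; rewrite /A /B A0 B2 add0r !eqxx.
  - by move: no3; rewrite /A /B A1 B1 eqxx andbT; case/eqP; ring.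
have [c [->|[A3 B1]] I] := evenD _ dphi; first by exists 0 => //; rewrite scale0r in I.
by move: no4; rewrite /A /B A3 B1 eqxx andbT; case/eqP; ring.
Qed.
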